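(* Let $k$ and $s$ be positive integers. Then, as $x\to\infty$, \[ \sum_{p_{1}\cdots p_{k}\leq x}\frac{\log^{s}(p_{1}\cdots p_{k})}{p_{1}\cdots p_{k}} =\sum_{l=0}^{k-1}(-1)^{l}\frac{A_{k}^{l+1}}{s^{l+1}}P_{k-1-l}(\log_{2}x)\cdot \log^{s}x+f(2)\log^{s-1}2+O\big(\log^{s-1}x\cdot(\log_{2}x)^{k}\big), \] where \[ f(x)=\sum_{l=0}^{k-1}(-1)^{l}A_{k}^{l+1}P_{k-1-l}(\log_{2}x)\cdot\log x . \]
   Context: Throughout, $p,p_1,p_2,\dots$ denote prime numbers, and $\sum_{p_1\cdots p_k\le x}$ denotes a sum over all ordered $k$-tuples $(p_1,\dots,p_k)$ of primes with $p_1\cdots p_k\le x$. $\log_2 x=\log(\log x)$. $B\approx 0.261$ is the Mertens constant, i.e. $B=\lim_{x\to\infty}\big(\sum_{p\le x}1/p-\log_2 x\big)$. $C_k^l=\binom{k}{l}$ and $A_k^l=\binom{k}{l}\, l!$. $\zeta$ is the Riemann zeta function. The sequence $(a_n)_{n\ge 2}$ is defined by $a_2=-\zeta(2)$, $a_3=2\zeta(3)$, $a_4=3\zeta(2)^2-6\zeta(4)$, and for $n>4$, $a_n=\sum_{i=1}^{n-3}(-1)^i C_{n-1}^{i}\, i!\,\zeta(i+1)\,a_{n-1-i}+(-1)^{n-1}(n-1)!\,\zeta(n)$. The polynomials $P_j$ are $P_0(y)=1$, $P_1(y)=y+B$, and for $j\ge 2$, $P_j(y)=(y+B)^j+\sum_{m=2}^{j}C_j^m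 a_m (y+B)^{j-m}$. $f(x)=O(g(x))$ means $|f(x)|\le Mg(x)$ for some $M>0$ and all sufficiently large $x$. *)

(* Defs.v *)
From HB Require Import structures.
From mathcomp Require Import all_boot all_order all_algebra.
From mathcomp Require Import all_classical all_reals all_analysis.

Set Implicit Arguments.
Unset Strict Implicit.
Unset Printing Implicit Defensive.

Import Order.TTheory GRing.Theory Num.Theory.
Import numFieldNormedType.Exports.

Local Open Scope classical_set_scope.
Local Open Scope ring_scope.

Definition log2 {R : realType} (x : R) : R := ln (ln x).

Definition sum_inv_primes {R : realType} (x : R) : R :=
  \sum_(p < (Num.truncn x).+1 | prime p) (p%:R)^-1.

Definition mertensB (R : realType) : R :=
  lim ((sum_inv_primes x - log2 x) @[x --> (+oo : set_system R)]).

(* Only used at integers n >= 2, where zeta is given by its Dirichlet series. *)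
Definition zeta (R : realType) (n : nat) : R :=
  limn (series (fun m : nat => (m.+1%:R ^+ n)^-1 : R)).

Definition arr (k l : nat) : nat := ('C(k, l) * l`!)%N.

(* One step of the course-of-values recursion for a_n, reading the earlier     *)
(* values from [prev]; the value 0 at n = 0, 1, where a_n is undefined, is     *)
(* junk that is never read.                                                    *)
Definition a_step {R : realType} (prev : nat -> R) (n : nat) : R :=
  match n with
  | 0 | 1 => 0
  | 2 => - zeta R 2
  | 3 => 2%:R * zeta R 3
  | 4 => 3%:R * zeta R 2 ^+ 2 - 6%:R * zeta R 4
  | _ => \sum_(1 <= i < n - 2)
           (-1) ^+ i * 'C(n - 1, i)%:R * i`!%:R * zeta R i.+1 * prev (n - 1 - i)%N
         + (-1) ^+ (n - 1) * (n - 1)`!%:R * zeta R n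
  end.

Fixpoint a_fuel (R : realType) (fuel n : nat) : R :=
  if fuel is fuel'.+1 then a_step (@a_fuel R fuel') n else 0.

Definition acoef (R : realType) (n : nat) : R := a_fuel R n.+1 n.

Lemma eq_a_step (R : realType) (u v : nat -> R) (n : nat) :
  (forall m, (m < n)%N -> u m = v m) -> a_step u n = a_step v n.
Proof.
case: n => [|[|[|[|[|n]]]]] //= uv; congr (_ + _).
rewrite big_nat [RHS]big_nat; apply: eq_bigr => i /andP[i1 _].
by rewrite uv // -subnDA ltn_subrL.
Qed.

Lemma a_fuelE (R : realType) (N n : nat) : (n < N)%N -> a_fuel R N n = acoef R n.
Proof.
elim/ltn_ind: n N => n IH [//|N] nN; rewrite /acoef /=; apply: eq_a_step => m mn.
by rewrite !IH // (leq_trans mn).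
Qed.

Lemma acoef2 (R : realType) : acoef R 2 = - zeta R 2. Proof. by []. Qed.

Lemma acoef3 (R : realType) : acoef R 3 = 2%:R * zeta R 3. Proof. by []. Qed.

Lemma acoef4 (R : realType) :
  acoef R 4 = 3%:R * zeta R 2 ^+ 2 - 6%:R * zeta R 4.
Proof. by []. Qed.

Lemma acoefE (R : realType) (n : nat) : (4 < n)%N ->
  acoef R n =
    \sum_(1 <= i < n - 2)
      (-1) ^+ i * 'C(n - 1, i)%:R * i`!%:R * zeta R i.+1 * acoef R (n - 1 - i)
    + (-1) ^+ (n - 1) * (n - 1)`!%:R * zeta R n.
Proof.
move=> n4; have -> : acoef R n = a_step (acoef R) n.
  by rewrite {1}/acoef /=; apply: eq_a_step => m mn; exact: a_fuelE.
by case: n n4 => [|[|[|[|[|n]]]]].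
Qed.

Definition Pj (R : realType) (j : nat) (y : R) : R :=
  let z := y + mertensB R in
  match j with
  | 0 => 1
  | 1 => z
  | _ => z ^+ j + \sum_(2 <= m < j.+1) 'C(j, m)%:R * acoef R m * z ^+ (j - m)
  end.

(* Each p_i in an admissible k-tuple is at most p_1 * ... * p_k <= x, so it    *)
(* loses nothing to let the p_i range over the integers 0, ..., floor x.       *)
Definition prime_tuple_sum (R : realType) (k s : nat) (x : R) : R :=
  \sum_(p : {ffun 'I_k -> 'I_(Num.truncn x).+1} |
        [forall i, prime (p i)] && ((\prod_(i < k) p i)%N%:R <= x))
    ln ((\prod_(i < k) p i)%N%:R) ^+ s / (\prod_(i < k) p i)%N%:R.

Definition fmain (R : realType) (k : nat) (x : R) : R :=
  \sum_(0 <= l < k)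
    (-1) ^+ l * (arr k l.+1)%:R * Pj (k - 1 - l) (log2 x) * ln x.

(* Main.v *)
Require Import Defs.
From HB Require Import structures.
From mathcomp Require Import all_boot all_order all_algebra.
From mathcomp Require Import all_classical all_reals all_analysis.
From mathcomp Require Import ring lra zify.

(* In the variable log t, the measure with mass log p / p at each prime p is the
   Lebesgue measure up to a bounded remainder (Mertens), so Abel summation
   evaluates sums over primes of functions of bounded variation of log p.
   Write u = log x, and let V_k(x) be the sum of log (x / (p_1 ... p_k)) /
   (p_1 ... p_k) over the tuples with product at most x.  Then V_{k+1}(x) is the
   sum of V_k(x / p) / p, and the weight log (x / n) vanishes at n = x, so that no
   prime close to x does any harm.  If V_k(x) = u R_k(log u) + O(log^k u), then
   expanding R_k(log u + log w) with w = 1 - log p / u reduces V_{k+1} to the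
   integrals of w log^i w / (1 - w) over [0, 1], which are (-1)^i i! (zeta(i+1) - 1)
   by the geometric series; Mertens' second theorem supplies the term i = 0.
   This gives R_{k+1} from R_k.  Since log (p_1 ... p_k) is a sum of k terms, the
   sum with weight log^s n over k+1 primes is, up to O(u^(s-1) log^k u), equal to
   (k+1)/s (u^s T_k - S_{k,s}), where T_k is the sum of 1 / (p_1 ... p_k) and
   S_{k,s} the sum with weight log^s n over k primes.  For s = 1 this gives
   T_k = (R_k + R_k')(log u) + O(log^k u / u), and R_k + R_k' = P_k because both are
   Appell sequences with the same values a_k at -B.  For general s it is a
   recursion in k whose solution is the claimed expansion. *)

Set Implicit Arguments.
Unset Strict Implicit.
Unset Printing Implicit Defensive.

Import Order.TTheory GRing.Theory Num.Theory.
Import numFieldNormedType.Exports.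

Local Open Scope classical_set_scope.
Local Open Scope ring_scope.

(** * Chebyshev's bound on the product of the primes up to n *)

Section Primorial.
Local Open Scope nat_scope.
Lemma prod_primes_dvd (a b n : nat) :
  (forall p, prime p -> a <= p < b -> p %| n) ->
  \prod_(a <= p < b | prime p) p %| n.
Proof.
elim: b => [|b IH] H; first by rewrite big_geq.
case: (leqP a b) => ab; last by rewrite big_geq // .
rewrite big_mkcond big_nat_recr //= -big_mkcond.
have IHb : \prod_(a <= p < b | prime p) p %| n.
  by apply: IH => p pp /andP[h1 h2]; apply: H => //; rewrite h1 ltnW.
case: ifP => pb; last by rewrite muln1.
rewrite Gauss_dvd ?IHb ?H ?ab ?leqnn //.
rewrite coprime_sym prime_coprime //.
rewrite Euclid_dvd_prod // big_has_cond.
apply/hasPn => i; rewrite mem_index_iota => /andP[_ ib].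
rewrite negb_and; case: (boolP (prime i)) => //= pi.
by rewrite dvdn_prime2 // neq_ltn ib orbT.
Qed.

(** Row 2m + 1 sums to 2^(2m+1) and has two equal central entries, so each is at most half of
    that. *)
Lemma bin_middle_le m : 'C(m.*2.+1, m) <= 4 ^ m.
Proof.
have H : 'C(m.*2.+1, m) + 'C(m.*2.+1, m.+1) <= 2 ^ m.*2.+1.
  have -> : 2 ^ m.*2.+1 = \sum_(i < m.*2.+2) 'C(m.*2.+1, i).
    rewrite -[2]/(1 + 1) expnDn; apply: eq_bigr => i _.
    by rewrite !exp1n !muln1.
  have h1 : m < m.*2.+2 by lia.
  have h2 : m.+1 < m.*2.+2 by lia.
  rewrite (bigD1 (Ordinal h1)) //= (bigD1 (Ordinal h2)) /=; last by rewrite -val_eqE /=; lia.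
  by rewrite addnA leq_addr.
have E : 'C(m.*2.+1, m.+1) = 'C(m.*2.+1, m).
  by rewrite -bin_sub; [congr 'C(_, _); lia|lia].
by move: H; rewrite E addnn -mul2n expnS leq_pmul2l // -mul2n expnM.
Qed.

(** Erdos's induction: an even n > 2 is not prime, and for n = 2m + 1 the primes in ]m + 1, 2m + 1]
    divide the central binomial coefficient, at most 4^m, while the primes up to m + 1 fall to the
    induction hypothesis. *)
Lemma primorial_le n : \prod_(0 <= p < n.+1 | prime p) p <= 4 ^ n.
Proof.
elim/ltn_ind: n => n IH.
have [|n2] := leqP n 2.
  by case: n IH => [|[|[|//]]] _ _; rewrite unlock.
have [on|en] := boolP (odd n); last first.
  rewrite big_mkcond big_nat_recr //= -big_mkcond.
  have -> : prime n = false.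
    by apply/negP => pn; case: (even_prime pn) => [n2e|]; [lia|rewrite (negbTE en)].
  rewrite muln1; case: n IH n2 en => // n IH n2 en.
  by apply: leq_trans (IH n _) _ => //; rewrite leq_exp2l.
have [m em] : exists m, n = m.*2.+1.
  by exists n./2; rewrite -[LHS]odd_double_half on.
subst n.
rewrite (@big_cat_nat _ _ _ m.+2) /=; [|lia|lia].
have -> : 4 ^ m.*2.+1 = 4 ^ m.+1 * 4 ^ m by rewrite -expnD; congr (_ ^ _); lia.
apply: leq_mul; first by apply: IH; lia.
apply: leq_trans (bin_middle_le m); apply: dvdn_leq; first by rewrite bin_gt0; lia.
apply: prod_primes_dvd => p pp /andP[h1 h2].
have : p %| (m.*2.+1)`! by apply: dvdn_fact; rewrite prime_gt0.
have le : m <= m.*2.+1 by lia.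
rewrite -(bin_fact le) Euclid_dvdM // => /orP[//|].
have big i : i < p -> ~~ (p %| i`!).
  move=> ip; rewrite fact_prod Euclid_dvd_prod // big_has.
  apply/hasPn => j; rewrite mem_index_iota => /andP[j0 ji].
  by rewrite gtnNdvd //; lia.
by rewrite Euclid_dvdM // !(negbTE (big _ _)) //; lia.
Qed.

End Primorial.

(** * Mertens' first theorem with an explicit constant *)

Section MertensFirst.
Variable R : realType.
Implicit Types (f g : nat -> R) (n N p : nat) (x y t : R).

Definition prime_sum N f : R := \sum_(0 <= p < N.+1 | prime p) f p.

Lemma prime_sum0 f : prime_sum 0 f = 0.
Proof. by rewrite /prime_sum big_mkcond big_nat1. Qed.

Lemma prime_sumS N f : prime_sum N.+1 f = prime_sum N f + (if prime N.+1 then f N.+1 else 0).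
Proof. by rewrite /prime_sum big_mkcond big_nat_recr //= -big_mkcond. Qed.

Lemma eq_prime_sum N f g : (forall p, prime p -> (p <= N)%N -> f p = g p) ->
  prime_sum N f = prime_sum N g.
Proof.
by move=> fg; rewrite /prime_sum big_nat_cond [RHS]big_nat_cond; apply: eq_bigr => p /andP[h pp]; apply: fg.
Qed.

Lemma ler_prime_sum N f g : (forall p, prime p -> (p <= N)%N -> f p <= g p) ->
  prime_sum N f <= prime_sum N g.
Proof.
by move=> fg; rewrite /prime_sum big_nat_cond [leRHS]big_nat_cond; apply: ler_sum => p /andP[h pp]; apply: fg.
Qed.

Lemma prime_sum_ge0 N f : (forall p, prime p -> (p <= N)%N -> 0 <= f p) -> 0 <= prime_sum N f.
Proof.
by move=> f0; rewrite /prime_sum big_nat_cond; apply: sumr_ge0 => p /andP[h pp]; apply: f0.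
Qed.

Lemma prime_sumD N f g : prime_sum N (fun p => f p + g p) = prime_sum N f + prime_sum N g.
Proof. exact: big_split. Qed.

Lemma prime_sumB N f g : prime_sum N (fun p => f p - g p) = prime_sum N f - prime_sum N g.
Proof. by rewrite /prime_sum sumrB. Qed.

Lemma prime_sumZ N (c : R) f : prime_sum N (fun p => c * f p) = c * prime_sum N f.
Proof. by rewrite /prime_sum mulr_sumr. Qed.

Lemma ler_norm_prime_sum N f : `|prime_sum N f| <= prime_sum N (fun p => `|f p|).
Proof. exact: ler_norm_sum. Qed.

Lemma ln_le_subr1 x : 0 < x -> ln x <= x - 1.
Proof. by move=> x0; rewrite -[X in ln X](subrK 1) addrC; apply: le_ln1Dx; lra. Qed.

Lemma ln_natM (m n : nat) : (0 < m)%N -> (0 < n)%N ->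
  ln (m * n)%:R = ln m%:R + ln n%:R :> R.
Proof. by move=> m0 n0; rewrite natrM lnM // posrE ltr0n. Qed.

Lemma ln_prod (I : Type) (r : seq I) (P : pred I) (F : I -> nat) :
  (forall i, P i -> 0 < F i)%N ->
  ln (\prod_(i <- r | P i) F i)%:R = \sum_(i <- r | P i) ln (F i)%:R :> R.
Proof.
move=> F0; elim: r => [|i r IH]; first by rewrite !big_nil ln1.
rewrite !big_cons; case: ifP => // Pi; rewrite ln_natM ?IH ?F0 //.
by rewrite prodn_cond_gt0.
Qed.

Lemma ler_ln_nat (m n : nat) : (0 < m)%N -> (m <= n)%N -> ln m%:R <= ln n%:R :> R.
Proof.
by move=> m0 mn; rewrite ler_ln ?posrE ?ltr0n ?ler_nat // (leq_trans m0).
Qed.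

Lemma ln_nat_ge0 n : 0 <= ln n%:R :> R.
Proof. by case: n => [|n]; [rewrite ln0|rewrite ln_ge0 // ler1n]. Qed.

Lemma chebyshev_theta_le N : prime_sum N (fun p => ln p%:R) <= N%:R * ln 4.
Proof.
rewrite /prime_sum -ln_prod => [|p /prime_gt0//].
have -> : N%:R * ln 4 = ln (4 ^ N)%N%:R :> R.
  by rewrite natrX lnXn // mulr_natl.
apply: ler_ln_nat; last exact: primorial_le.
by rewrite prodn_cond_gt0 // => p /prime_gt0.
Qed.

Lemma ln_fact_le N : ln N`!%:R <= N%:R * ln N%:R :> R.
Proof.
elim: N => [|N IH]; first by rewrite ln1 mul0r.
rewrite factS ln_natM ?fact_gt0 // -{2}natr1 mulrDl mul1r addrC lerD2r.
apply: le_trans IH _; case: N => [|N]; first by rewrite !mul0r.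
by rewrite ler_wpM2l // ler_ln_nat.
Qed.

Lemma ln_succ_sub_le n : (0 < n)%N -> ln n.+1%:R - ln n%:R <= n%:R^-1 :> R.
Proof.
move=> n0; have nR : 0 < n%:R :> R by rewrite ltr0n.
rewrite -ln_div ?posrE ?ltr0n //; apply: le_trans (ln_le_subr1 _) _.
  by rewrite divr_gt0 ?ltr0n.
by rewrite -natr1 mulrDl divff ?lt0r_neq0 // mul1r addrC addKr.
Qed.

Lemma ln_fact_ge N : N%:R * ln N%:R - N%:R <= ln N`!%:R :> R.
Proof.
elim: N => [|N IH]; first by rewrite ln1 mul0r subrr.
rewrite factS ln_natM ?fact_gt0 //.
case: N IH => [|N] IH; first by rewrite fact0 ln1; lra.
have h : N.+1%:R * (ln N.+2%:R - ln N.+1%:R) <= 1 :> R.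
  rewrite mulrC -ler_pdivlMr ?ltr0n // mul1r; exact: ln_succ_sub_le.
by move: h IH; set l := ln N.+2%:R => h IH; rewrite -(natr1 N.+1); lra.
Qed.

Lemma ln_factE N : ln N`!%:R = prime_sum N (fun p => (logn p N`!)%:R * ln p%:R) :> R.
Proof.
have E n : (0 < n <= N)%N -> ln n%:R = prime_sum N (fun p => (logn p n)%:R * ln p%:R) :> R.
  move=> /andP[n0 nN]; rewrite -{1}(partnT n0) (widen_partn _ nN) ln_prod; last first.
    by move=> p _; rewrite expn_gt0; case: p => //; rewrite lognE.
  rewrite /prime_sum [RHS]big_mkcond; apply: eq_bigr => p _; case: ifP => pp.
    by rewrite natrX lnXn ?ltr0n ?prime_gt0 // mulr_natl.
  by rewrite lognE pp /= expn0 ln1.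
suff H n : (n <= N)%N -> ln n`!%:R = prime_sum N (fun p => (logn p n`!)%:R * ln p%:R) :> R.
  exact: H.
elim: n => [|n IH] nN.
  by rewrite ln1 /prime_sum big1 // => p _; rewrite fact0 logn1 mul0r.
rewrite factS ln_natM ?fact_gt0 // E ?nN // IH 1?ltnW // -prime_sumD.
by apply: eq_prime_sum => p _ _; rewrite lognM ?fact_gt0 // natrD mulrDl.
Qed.

(** Only the first term of Legendre's formula, the integer part of N / p, is kept. *)
Lemma logn_fact_ge N p : prime p -> N%:R / p%:R - 1 <= (logn p N`!)%:R :> R.
Proof.
move=> pp; have p0 : 0 < p%:R :> R by rewrite ltr0n prime_gt0.
case: N => [|N]; first by rewrite mul0r sub0r; apply: le_trans (ler0n _ _); lra.
have h : (N.+1 %/ p <= logn p N.+1`!)%N.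
  by rewrite logn_fact // big_ltn // expn1 leq_addr.
apply: le_trans (_ : (N.+1 %/ p)%:R <= _); last by rewrite ler_nat.
rewrite lerBlDr natr1 ler_pdivrMr // -natrM ler_nat ltnW // ltn_ceil //.
exact: prime_gt0.
Qed.

Lemma logn_fact_le N p : prime p -> (logn p N`!)%:R <= N%:R / (p%:R - 1) :> R.
Proof.
move=> pp; have p1 := prime_gt1 pp.
(* Legendre's sum is compared with a geometric series: the invariant carries the last quotient, and
   p times the next quotient is at most the current one. *)
have H m : ((p - 1) * \sum_(1 <= k < m.+1) (N %/ p ^ k) + N %/ p ^ m <= N)%N.
  elim: m => [|m IH]; first by rewrite big_geq // expn0 divn1 muln0.
  rewrite big_nat_recr //=; apply: leq_trans IH; rewrite mulnDr -addnA leq_add2l.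
  rewrite -[X in (_ + X)%N]mul1n -mulnDl subnK ?(ltnW p1) //.
  by rewrite expnSr divnMA mulnC leq_trunc_div.
have p1' : 0 < p%:R - 1 :> R by rewrite subr_gt0 ltr1n.
rewrite ler_pdivlMr // -(natrB _ (ltnW p1)) -natrM ler_nat logn_fact // mulnC.
exact: leq_trans (leq_addr _ _) (H N).
Qed.

Definition mertensA N : R := prime_sum N (fun p => ln p%:R / p%:R).

(** Insert the lower bound for the exponents into the factorization of N!, with log N! <= N log N;
    the subtracted 1 costs theta(N) <= N log 4 in total. *)
Lemma mertensA_le N : (0 < N)%N -> mertensA N <= ln N%:R + ln 4.
Proof.
move=> N0; have NR : 0 < N%:R :> R by rewrite ltr0n.
rewrite -(ler_pM2l NR) mulrDr.
have h1 : N%:R * mertensA N - prime_sum N (fun p => ln p%:R) <= ln N`!%:R.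
  rewrite ln_factE -prime_sumZ -prime_sumB; apply: ler_prime_sum => p pp _.
  apply: le_trans (_ : (N%:R / p%:R - 1) * ln p%:R <= _).
    by rewrite mulrBl mul1r mulrA mulrAC.
  by rewrite ler_wpM2r ?ln_nat_ge0 // logn_fact_ge.
have := ln_fact_le N; have := chebyshev_theta_le N; lra.
Qed.

(** The subtracted term is tailored to the induction: with a = N + 1 the step reduces to (a + 1)
    (log (a + 1) - log a) <= 2. *)
Lemma sum_ln_div_le N :
  \sum_(2 <= n < N.+2) ln n%:R / (n%:R * (n%:R - 1)) <= 2 - (ln N.+1%:R + 2) / N.+1%:R :> R.
Proof.
elim: N => [|N IH]; first by rewrite big_geq // ln1; lra.
rewrite big_nat_recr //=; apply: le_trans (lerD IH (lexx _)) _.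
set a : R := N.+1%:R; have a1 : 1 <= a by rewrite ler1n.
have -> : N.+2%:R = a + 1 :> R by rewrite natr1.
have h : a * (ln (a + 1) - ln a) <= 1.
  rewrite mulrC -ler_pdivlMr; last lra.
  by rewrite mul1r /a natr1; exact: ln_succ_sub_le.
rewrite -subr_ge0.
have -> : 2 - (ln (a + 1) + 2) / (a + 1) -
   (2 - (ln a + 2) / a + ln (a + 1) / ((a + 1) * (a + 1 - 1))) =
   (2 - (a + 1) * (ln (a + 1) - ln a)) / (a * (a + 1)).
  by field; apply/andP; split; apply: lt0r_neq0; lra.
apply: divr_ge0; last by nra.
have : ln (a + 1) - ln a <= 1.
  rewrite /a natr1; apply: le_trans (ln_succ_sub_le _) _ => //.
  by rewrite invf_le1 ?ltr0n // ler1n.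
lra.
Qed.

(** The upper bound N / (p - 1) for the exponents bounds the sum of log p / (p - 1) from below.
    Passing from p - 1 to p costs at most 2, by comparison with a sum over all integers, and the -N
    in [ln_fact_ge] costs 1. *)
Lemma mertensA_ge N : (0 < N)%N -> ln N%:R - 3 <= mertensA N.
Proof.
move=> N0; have NR : 0 < N%:R :> R by rewrite ltr0n.
have h1 : ln N`!%:R <= N%:R * prime_sum N (fun p => ln p%:R / (p%:R - 1)).
  rewrite ln_factE -prime_sumZ; apply: ler_prime_sum => p pp _.
  by rewrite mulrCA mulrC ler_wpM2l ?ln_nat_ge0 // logn_fact_le.
have h2 : prime_sum N (fun p => ln p%:R / (p%:R - 1)) - mertensA N <= 2.
  rewrite -prime_sumB.
  apply: le_trans (_ : \sum_(2 <= n < N.+1) ln n%:R / (n%:R * (n%:R - 1)) <= _).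
    rewrite [leRHS](_ : _ = \sum_(0 <= n < N.+1 | (1 < n)%N) ln n%:R / (n%:R * (n%:R - 1))); last first.
      by case: N N0 {NR h1} => // N _; rewrite [RHS]big_mkcond [RHS]big_ltn // [X in _ = _ + X]big_ltn //= !add0r
        big_nat [RHS]big_nat; apply: eq_bigr => n /andP[-> _].
    rewrite /prime_sum [leRHS]big_mkcond [leLHS]big_mkcond /=; apply: ler_sum => p _.
    case: (boolP (prime p)) => pp; last first.
      by case: ifP => // p1; rewrite divr_ge0 ?ln_nat_ge0 // mulr_ge0 // subr_ge0 ler1n ltnW.
    rewrite prime_gt1 //.
    have : 1 < p%:R :> R by rewrite ltr1n prime_gt1.
    by move=> p1; rewrite le_eqVlt; apply/orP; left; apply/eqP; field; apply/andP; split; apply: lt0r_neq0; lra.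
  case: N N0 {NR h1} => // N _; apply: le_trans (sum_ln_div_le _) _.
  by rewrite lerBlDr lerDl divr_ge0 // addr_ge0 // ln_nat_ge0.
have h3 : N%:R * (ln N%:R - 1) <= N%:R * prime_sum N (fun p => ln p%:R / (p%:R - 1)).
  by apply: le_trans h1; have := ln_fact_ge N; lra.
rewrite ler_pM2l // in h3; lra.
Qed.

Definition mertens_rem t : R := mertensA (Num.truncn t) - ln t.

Lemma mertens_rem_le t : 1 <= t -> `|mertens_rem t| <= 4.
Proof.
move=> t1; have N0 : (0 < Num.truncn t)%N by rewrite truncn_gt0.
have t0 : 0 <= t by lra.
have /andP[h1 h2] := truncn_itv t0; set N := Num.truncn t in N0 h1 h2 *.
have NR : 0 < N%:R :> R by rewrite ltr0n.
have l1 : ln N%:R <= ln t by rewrite ler_ln ?posrE //; lra.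
have l2 : ln t <= ln N%:R + 1.
  apply: le_trans (_ : ln N.+1%:R <= _); first by rewrite ler_ln ?posrE ?ltr0n //; lra.
  have := ln_succ_sub_le N0; have : N%:R^-1 <= 1 :> R by rewrite invf_le1 // ler1n.
  lra.
have l4 : ln 4 <= 3 :> R by apply: le_trans (ln_le_subr1 _) _; lra.
have := mertensA_le N0; have := mertensA_ge N0; rewrite /mertens_rem -/N ler_norml; lra.
Qed.
End MertensFirst.

(** * Abel summation over primes and Mertens' second theorem *)

Section MertensSecond.
Variable R : realType.
Implicit Types (x y t : R).

(* Abel summation against the measure log p / p, which is dt / t up to a
   bounded remainder; m plays the role of the variation of g. *)
Lemma prime_sum_ln_approx (M : nat) (y : R) (g G m : R -> R) :
  (0 < M)%N -> M%:R <= y ->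
  (forall a b, ln M%:R <= a -> a <= b -> b <= ln y -> `|g b - g a| <= m b - m a) ->
  (forall a b, ln M%:R <= a -> a <= b -> b <= ln y ->
     `|G b - G a - g b * (b - a)| <= (m b - m a) * (b - a)) ->
  `|prime_sum (Num.truncn y) (fun p => ln p%:R / p%:R * g (ln p%:R))
    - prime_sum M (fun p => ln p%:R / p%:R * g (ln p%:R)) - (G (ln y) - G (ln M%:R))|
    <= 4 * `|g (ln y)| + 4 * `|g (ln M%:R)| + 5 * (m (ln y) - m (ln M%:R)).
Proof.
move=> M0 My Hg HG; set F := fun p : nat => _.
have M1 : 1 <= M%:R :> R by rewrite ler1n.
have y0 : 0 <= y by lra.
(* The discrepancy minus the boundary term of the Abel summation; its increments involve only
   increments of [g] and [G]. *)
pose D t := prime_sum (Num.truncn t) F - G (ln t) - mertens_rem t * g (ln t).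
(* [c] is the jump of [mertensA]. The 5 is 1 from [G], since log b - log a <= 1, plus the bound 4 on
   [mertens_rem]. *)
have step a b c : M%:R <= a -> a <= b -> b <= y -> ln b - ln a <= 1 ->
    prime_sum (Num.truncn b) F = prime_sum (Num.truncn a) F + c * g (ln b) ->
    mertensA R (Num.truncn b) = mertensA R (Num.truncn a) + c ->
    `|D b - D a| <= 5 * (m (ln b) - m (ln a)).
  move=> Ma ab bY lab1 EF EA.
  have la : ln M%:R <= ln a by rewrite ler_ln ?posrE //; lra.
  have lab : ln a <= ln b by rewrite ler_ln ?posrE //; lra.
  have lb : ln b <= ln y by rewrite ler_ln ?posrE //; lra.
  have Er : mertens_rem b = mertens_rem a + c - (ln b - ln a).
    by rewrite /mertens_rem EA; ring.
  have -> : D b - D a = - (G (ln b) - G (ln a) - g (ln b) * (ln b - ln a))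
      - mertens_rem a * (g (ln b) - g (ln a)).
    by rewrite /D EF Er; ring.
  have h1 := Hg _ _ la lab lb; have h2 := HG _ _ la lab lb.
  have h3 : 0 <= m (ln b) - m (ln a) by apply: le_trans h1.
  apply: le_trans (ler_normB _ _) _; rewrite normrN normrM.
  apply: le_trans (_ : (m (ln b) - m (ln a)) * 1 + 4 * (m (ln b) - m (ln a)) <= _); last lra.
  apply: lerD; first by apply: le_trans h2 _; apply: ler_wpM2l.
  by apply: ler_pM => //; apply: mertens_rem_le; lra.
have Hnat n : (M <= n)%N -> n%:R <= y ->
    `|D n%:R - D M%:R| <= 5 * (m (ln n%:R) - m (ln M%:R)).
  elim: n => [|n IH] Mn ny; first by move: Mn M0; rewrite leqn0 => /eqP ->.
  move: Mn; rewrite leq_eqVlt => /orP[/eqP <-|Mn]; first by rewrite !subrr normr0 mulr0.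
  have nS : n%:R <= n.+1%:R :> R by rewrite ler_nat.
  have n0 : (0 < n)%N := leq_trans M0 Mn.
  have {}IH := IH Mn (le_trans nS ny).
  have := @step n%:R n.+1%:R (if prime n.+1 then ln n.+1%:R / n.+1%:R else 0).
  rewrite !natrK ler_nat => /(_ Mn nS ny) h.
  have : `|D n.+1%:R - D n%:R| <= 5 * (m (ln n.+1%:R) - m (ln n%:R)).
    apply: h.
    - apply: le_trans (ln_succ_sub_le _ n0) _.
      by rewrite invf_le1 ?ltr0n // ler1n.
    - by rewrite prime_sumS /F; case: ifP => // _; rewrite mul0r.
    - by rewrite /mertensA prime_sumS; case: ifP.
  have -> : D n.+1%:R - D M%:R = (D n.+1%:R - D n%:R) + (D n%:R - D M%:R) by ring.
  move=> {}h; apply: le_trans (ler_normD _ _) _; lra.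
have /andP[N1 N2] := truncn_itv y0; set N := Num.truncn y in N1 N2 *.
have MN : (M <= N)%N by rewrite truncn_ge_nat.
have N0 : (0 < N)%N := leq_trans M0 MN.
have N0R : 0 < N%:R :> R by rewrite ltr0n.
have hN := Hnat N MN N1.
have hy : `|D y - D N%:R| <= 5 * (m (ln y) - m (ln N%:R)).
  apply: (@step _ _ 0) => //; rewrite ?natrK ?mul0r ?addr0 ?ler_nat //.
  have := ln_succ_sub_le R N0; have : N%:R^-1 <= 1 :> R by rewrite invf_le1 // ler1n.
  have : ln y <= ln N.+1%:R by rewrite ler_ln ?posrE ?ltr0n //; lra.
  lra.
have hD : `|D y - D M%:R| <= 5 * (m (ln y) - m (ln M%:R)).
  have -> : D y - D M%:R = (D y - D N%:R) + (D N%:R - D M%:R) by ring.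
  apply: le_trans (ler_normD _ _) _; lra.
have -> : prime_sum N F - prime_sum M F - (G (ln y) - G (ln M%:R)) =
   mertens_rem y * g (ln y) - mertens_rem M%:R * g (ln M%:R) + (D y - D M%:R).
  by rewrite /D natrK -/N; ring.
apply: le_trans (ler_normD _ _) _; apply: lerD => //.
apply: le_trans (ler_normB _ _) _; rewrite !normrM.
apply: lerD; apply: ler_wpM2r => //; apply: mertens_rem_le; lra.
Qed.

Definition prime_inv x : R := prime_sum (Num.truncn x) (fun p => p%:R^-1).

Lemma ln_sub_bounds (a b : R) : 0 < a -> a <= b ->
  (b - a) / b <= ln b - ln a <= (b - a) / a.
Proof.
move=> a0 ab; have b0 : 0 < b by lra.
apply/andP; split.
  have -> : ln b - ln a = - ln (a / b) by rewrite ln_div ?posrE // opprB.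
  rewrite lerNr; apply: le_trans (ln_le_subr1 _) _.
    exact: divr_gt0.
  by rewrite mulrBl divff ?lt0r_neq0 // opprB.
rewrite -ln_div ?posrE //; apply: le_trans (ln_le_subr1 _) _; first exact: divr_gt0.
by rewrite mulrBl divff ?lt0r_neq0.
Qed.

(** Abel summation with g(v) = 1 / v, whose primitive is log v and whose variation is the increase
    of -1 / v. *)
Lemma prime_inv_diff (M : nat) y : (1 < M)%N -> M%:R <= y ->
  `|prime_inv y - ln (ln y) - (prime_inv M%:R - ln (ln M%:R))| <= 13 / ln M%:R.
Proof.
move=> M1 My.
have lM : 0 < ln M%:R :> R by rewrite ln_gt0 // ltr1n.
have M0R : 0 < M%:R :> R by rewrite ltr0n ltnW.
have y0 : 0 < y by lra.
have lMy : ln M%:R <= ln y by rewrite ler_ln.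
have := @prime_sum_ln_approx M y (fun v => v^-1) (fun v => ln v) (fun v => - v^-1) (ltnW M1) My.
move=> H; have {H} : `|prime_inv y - prime_inv M%:R - (ln (ln y) - ln (ln M%:R))| <=
   4 * `|(ln y)^-1| + 4 * `|(ln M%:R)^-1| + 5 * (- (ln y)^-1 - - (ln M%:R)^-1).
  have E n : prime_sum n (fun p => ln p%:R / p%:R * (ln p%:R)^-1) = prime_sum n (fun p => p%:R^-1) :> R.
    apply: eq_prime_sum => p pp _; rewrite mulrAC divff ?mul1r //.
    by rewrite gt_eqF // ln_gt0 // ltr1n prime_gt1.
  move: H; rewrite /= !E /prime_inv natrK; apply.
    move=> a b Ma ab bY; rewrite distrC ger0_norm; first lra.
    by rewrite subr_ge0 lef_pV2 ?posrE //; lra.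
  move=> a b Ma ab bY.
  have a0 : 0 < a by lra.
  have /andP[h1 h2] := ln_sub_bounds a0 ab.
  rewrite ger0_norm; last by rewrite mulrC; lra.
  have -> : (- b^-1 - - a^-1) * (b - a) = (b - a) / a - (b - a) / b.
    by field; apply/andP; split; apply: lt0r_neq0; lra.
  by rewrite (mulrC b^-1); lra.
have h : (ln y)^-1 <= (ln M%:R)^-1 by rewrite lef_pV2 ?posrE //; lra.
have h0 : 0 < (ln y)^-1 by rewrite invr_gt0; lra.
have h0' : 0 < (ln M%:R)^-1 :> R by rewrite invr_gt0.
rewrite (gtr0_norm h0) (gtr0_norm h0') => H; apply: le_trans (_ : 4 * (ln y)^-1 + 4 * (ln M%:R)^-1 +
   5 * (- (ln y)^-1 - - (ln M%:R)^-1) <= _); last lra.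
by apply: le_trans H; rewrite le_eqVlt; apply/orP; left; apply/eqP; congr `|_|; ring.
Qed.

Lemma sum_inv_primesE x : sum_inv_primes x = prime_inv x.
Proof. by rewrite /sum_inv_primes /prime_inv /prime_sum big_mkord. Qed.

(** [mertensB] is a [lim], meaningful only once convergence is known. [prime_inv_diff] gives the
    Cauchy criterion, with M so large that 13 / log M < e. *)
Lemma mertensB_cvg :
  (sum_inv_primes x - log2 x) @[x --> (+oo : set_system R)] --> mertensB R.
Proof.
suff : cvg ((sum_inv_primes x - log2 x) @[x --> (+oo : set_system R)]) by [].
apply/cauchy_cvgP; apply: cauchy_exP => e e0.
pose M := (Num.truncn (expR (13 / e))).+2.
have lM : 13 / e < ln M%:R.
  rewrite -[ltLHS]expRK ltr_ln ?posrE ?expR_gt0 ?ltr0n //.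
  by apply: lt_trans (truncnS_gt _) _; rewrite ltr_nat.
exists (prime_inv M%:R - ln (ln M%:R)).
suff : \forall x \near (+oo : set_system R),
    ball (prime_inv M%:R - ln (ln M%:R)) e (sum_inv_primes x - log2 x) by [].
near=> x.
rewrite /ball /= sum_inv_primesE /log2 distrC.
apply: le_lt_trans (prime_inv_diff (isT : (1 < M)%N) _) _; first by near: x; apply: nbhs_pinfty_ge; rewrite num_real.
have l0 : 0 < 13 / e by rewrite divr_gt0.
by rewrite ltr_pdivrMr; [rewrite mulrC -ltr_pdivrMr|lra].
Unshelve. all: by end_near.
Qed.

(** With N = floor x, [prime_inv_diff] from N to x and from N to z, z tending to infinity, gives the
    error 26 / log N, which is at most 52 / log x because x < N + 1 <= N^2. *)
Lemma mertens_second x : 2 <= x -> `|prime_inv x - ln (ln x) - mertensB R| <= 52 / ln x.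
Proof.
move=> x2; have x0 : 0 <= x by lra.
have /andP[N1 N2] := truncn_itv x0; set N := Num.truncn x in N1 N2 *.
have N2' : (1 < N)%N by rewrite truncn_ge_nat.
have NR2 : 2 <= N%:R :> R by rewrite ler_nat.
have lN : 0 < ln N%:R :> R by rewrite ln_gt0 // ltr1n.
have h1 : `|mertensB R - (prime_inv N%:R - ln (ln N%:R))| <= 13 / ln N%:R.
  apply/ler_addgt0Pr => e e0.
  near (pinfty_nbhs R) => z.
  have hz : `|mertensB R - (prime_inv z - ln (ln z))| < e.
    near: z; have /cvgrPdist_lt /(_ e e0) := mertensB_cvg.
    by apply: filterS => z; rewrite sum_inv_primesE.
  have := @prime_inv_diff N z N2'.
  have Nz : N%:R <= z by near: z; apply: nbhs_pinfty_ge; rewrite num_real.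
  move=> /(_ Nz) h.
  have -> : mertensB R - (prime_inv N%:R - ln (ln N%:R)) = (mertensB R - (prime_inv z - ln (ln z)))
     + (prime_inv z - ln (ln z) - (prime_inv N%:R - ln (ln N%:R))) by ring.
  apply: le_trans (ler_normD _ _) _; lra.
have h2 := prime_inv_diff N2' N1.
have h3 : ln x <= 2 * ln N%:R.
  have -> : 2 * ln N%:R = ln (N%:R ^+ 2) :> R by rewrite lnXn ?mulr_natl // ltr0n ltnW.
  rewrite ler_ln ?posrE; [|lra|by rewrite exprn_gt0 // ltr0n ltnW].
  by move: N2; rewrite -natr1; nra.
have lx : 0 < ln x by rewrite ln_gt0 //; lra.
have h4 : 26 / ln N%:R <= 52 / ln x.
  by rewrite ler_pdivrMr // mulrAC ler_pdivlMr //; lra.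
apply: le_trans h4.
have -> : prime_inv x - ln (ln x) - mertensB R = (prime_inv x - ln (ln x) - (prime_inv N%:R - ln (ln N%:R)))
   - (mertensB R - (prime_inv N%:R - ln (ln N%:R))) by ring.
apply: le_trans (ler_normB _ _) _; lra.
Unshelve. all: by end_near.
Qed.
End MertensSecond.

(** * Integrals of w^n (-log w)^j over [0, 1] and the matching sums over primes *)

Section LogMoments.
Variable R : realType.
Implicit Types (n j : nat) (a b w : R).

Definition pow_nln n j w : R := w ^+ n * (- ln w) ^+ j.

(* The primitive of pow_nln n j on ]0, 1]; it extends continuously by 0 at 0, which
   is also its value there because ln 0 = 0. *)
Fixpoint pow_nln_prim n j w : R :=
  if j is j'.+1 then (pow_nln n.+1 j w + j%:R * pow_nln_prim n j' w) / n.+1%:R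
  else w ^+ n.+1 / n.+1%:R.

Lemma pow_nln_ge0 n j w : 0 <= w <= 1 -> 0 <= pow_nln n j w.
Proof.
move=> /andP[w0 w1]; rewrite mulr_ge0 ?exprn_ge0 //.
by rewrite oppr_ge0 ln_le0.
Qed.

Lemma pow_nln_prim0 n j : pow_nln_prim n j 0 = 0.
Proof.
elim: j => [|j IH] /=; first by rewrite expr0n mul0r.
by rewrite IH /pow_nln expr0n !mul0r mulr0 addr0 mul0r.
Qed.

(** As the primitive vanishes at 0, this is the integral of w^n (-log w)^j over [0, 1]; such values,
    summed over n, produce zeta(j + 1). *)
Lemma pow_nln_prim1 n j : pow_nln_prim n j 1 = j`!%:R / n.+1%:R ^+ j.+1.
Proof.
have n0 : n.+1%:R != 0 :> R by rewrite pnatr_eq0.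
elim: j => [|j IH] /=; first by rewrite expr1n.
rewrite IH /pow_nln ln1 oppr0 expr0n mulr0 add0r factS natrM -mulrA -mulrA.
by rewrite (exprSr _ j.+1) invfM !mulrA.
Qed.

Lemma pow_nln_prim_ge0 n j w : 0 <= w <= 1 -> 0 <= pow_nln_prim n j w.
Proof.
move=> w01; have /andP[w0 w1] := w01.
elim: j => [|j IH] /=; first by rewrite divr_ge0 ?exprn_ge0.
by rewrite divr_ge0 // addr_ge0 ?pow_nln_ge0 // mulr_ge0.
Qed.

(** The recursion of the primitive solved for its first term. It exhibits [pow_nln n.+1 j] as a
    difference of two functions nondecreasing on [0, 1]; at j = 0 the factor j makes the truncated
    [j.-1] harmless. *)
Lemma pow_nlnE n j w :
  pow_nln n.+1 j w = n.+1%:R * pow_nln_prim n j w - j%:R * pow_nln_prim n j.-1 w.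
Proof.
have n0 : n.+1%:R != 0 :> R by rewrite pnatr_eq0.
case: j => [|j] /=; first by rewrite /pow_nln expr0 mulr1 mul0r subr0 mulrC divfK.
by rewrite mulrC divfK // addrK.
Qed.

Lemma is_derive_pow_nln n j w : 0 < w ->
  is_derive w 1 (pow_nln n j)
    (n%:R * w ^+ n.-1 * (- ln w) ^+ j - w ^+ n * (j%:R * (- ln w) ^+ j.-1) / w).
Proof.
move=> w0.
have h1 := is_deriveX n (is_derive_id w (1 : R)).
have h2 := is_deriveX j (is_deriveN (is_derive1_ln w0)).
have := is_deriveM h1 h2.
have -> : ((id : R -> R) ^+ n) * ((- @ln R) ^+ j) = pow_nln n j.
  by apply/funext => z; rewrite /pow_nln !exprfctE.
move=> h; apply: is_derive_eq.
rewrite !exprfctE /GRing.scale /=.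
rewrite -[(- @ln R) w]/(- ln w); set A := _ ^+ j; set B := _ ^+ j.-1; ring.
Qed.

Lemma is_derive_pow_nln_prim n j w : 0 < w -> is_derive w 1 (pow_nln_prim n j) (pow_nln n j w).
Proof.
move=> w0; have n0 : n.+1%:R != 0 :> R by rewrite pnatr_eq0.
elim: j => [|j IH].
  have h := is_deriveZ n.+1%:R^-1 (is_derive_pow_nln n.+1 0 w0).
  have -> : pow_nln_prim n 0 = n.+1%:R^-1 \*: pow_nln n.+1 0.
    by apply/funext => z /=; rewrite /pow_nln expr0 mulr1 mulrC.
  apply: is_derive_eq; rewrite /GRing.scale /= /pow_nln !expr0 !mulr1 mulr0 mul0r subr0.
  by rewrite mulrA mulVf // mul1r.
have h := is_deriveZ n.+1%:R^-1 (is_deriveD (is_derive_pow_nln n.+1 j.+1 w0) (is_deriveZ j.+1%:R IH)).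
have -> : pow_nln_prim n j.+1 = n.+1%:R^-1 \*: (pow_nln n.+1 j.+1 + j.+1%:R \*: pow_nln_prim n j).
  by apply/funext => z /=; rewrite mulrC.
apply: is_derive_eq; rewrite /GRing.scale /= /pow_nln.
rewrite (exprS w n); move: (n.+1%:R) n0 => c c0.
by field; rewrite c0 (lt0r_neq0 w0).
Qed.

Lemma pow_nln_prim_mvt n j a b : 0 < a -> a < b ->
  exists2 c, a < c < b & pow_nln_prim n j b - pow_nln_prim n j a = pow_nln n j c * (b - a).
Proof.
move=> a0 ab.
have D x : x \in `]a, b[ -> is_derive x 1 (pow_nln_prim n j) (pow_nln n j x).
  by rewrite in_itv /= => /andP[ax _]; apply: is_derive_pow_nln_prim; lra.
have C : {within `[a, b], continuous (pow_nln_prim n j)}.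
  apply: derivable_within_continuous => x; rewrite in_itv /= => /andP[ax _].
  by have [] : is_derive x 1 (pow_nln_prim n j) (pow_nln n j x) by apply: is_derive_pow_nln_prim; lra.
by have [c] := MVT ab D C; rewrite in_itv /= => ? ?; exists c.
Qed.

Lemma pow_nln_prim_homo n j a b : 0 <= a -> a <= b -> b <= 1 -> pow_nln_prim n j a <= pow_nln_prim n j b.
Proof.
rewrite le_eqVlt => /orP[/eqP <- b0 b1|a0]; first by rewrite pow_nln_prim0 pow_nln_prim_ge0 ?b0.
rewrite le_eqVlt => /orP[/eqP <- //|ab b1].
have [c /andP[ac cb] E] := pow_nln_prim_mvt n j a0 ab.
by rewrite -subr_ge0 E mulr_ge0 ?pow_nln_ge0 //; lra.
Qed.

(** Follows term by term from the recursion of the primitive. It replaces the mean value theorem at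
    the endpoint 0, where the logarithm is singular. *)
Lemma pow_nln_prim_le n j w : 0 <= w <= 1 -> pow_nln_prim n.+1 j w <= w * pow_nln_prim n j w.
Proof.
move=> w01; have /andP[w0 w1] := w01.
have inv : n.+2%:R^-1 <= n.+1%:R^-1 :> R by rewrite lef_pV2 ?posrE ?ltr0n // ler_nat.
elim: j => [|j IH] /=.
  rewrite mulrA -exprS; apply: ler_wpM2l => //; exact: exprn_ge0.
rewrite mulrA; apply: ler_pM; rewrite ?invr_ge0 //.
  by rewrite addr_ge0 ?pow_nln_ge0 // mulr_ge0 // pow_nln_prim_ge0.
rewrite mulrDr; apply: lerD; first by rewrite /pow_nln (exprS w n.+1) mulrA.
by rewrite mulrCA; apply: ler_wpM2l.
Qed.

(* Dominates the variation of pow_nln n.+1 j, by [pow_nlnE]. *)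
Definition pow_nln_var n j w : R := n.+1%:R * pow_nln_prim n j w + j%:R * pow_nln_prim n j.-1 w.

Lemma pow_nln_var0 n j : pow_nln_var n j 0 = 0.
Proof. by rewrite /pow_nln_var !pow_nln_prim0 !mulr0 addr0. Qed.

Lemma pow_nln_var1_le n j : pow_nln_var n j 1 <= 2 * j`!%:R / n.+1%:R ^+ j.
Proof.
have n0 : n.+1%:R != 0 :> R by rewrite pnatr_eq0.
have E1 : n.+1%:R * pow_nln_prim n j 1 = j`!%:R / n.+1%:R ^+ j.
  by rewrite pow_nln_prim1 exprS invfM mulrCA mulVKf.
rewrite /pow_nln_var E1 -[leRHS]mulrA (mulr_natl _ 2) mulr2n lerD2l.
case: j {E1} => [|j]; first by rewrite mul0r divr_ge0.
by rewrite pow_nln_prim1 factS natrM mulrA.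
Qed.

Lemma pow_nln_variation n j a b : 0 <= a -> a <= b -> b <= 1 ->
  `|pow_nln n.+1 j b - pow_nln n.+1 j a| <= pow_nln_var n j b - pow_nln_var n j a.
Proof.
move=> a0 ab b1; rewrite !pow_nlnE /pow_nln_var.
have h1 : 0 <= n.+1%:R * (pow_nln_prim n j b - pow_nln_prim n j a).
  by rewrite mulr_ge0 // subr_ge0 pow_nln_prim_homo.
have h2 : 0 <= j%:R * (pow_nln_prim n j.-1 b - pow_nln_prim n j.-1 a).
  by rewrite mulr_ge0 // subr_ge0 pow_nln_prim_homo.
rewrite ler_norml; lra.
Qed.

Lemma pow_nln_var_homo n j a b : 0 <= a -> a <= b -> b <= 1 -> pow_nln_var n j a <= pow_nln_var n j b.
Proof.
by move=> a0 ab b1; rewrite /pow_nln_var; apply: lerD; apply: ler_wpM2l => //; apply: pow_nln_prim_homo.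
Qed.

(** For a > 0 the increment is b - a times a value of [pow_nln] between a and b, whose distance to
    the value at a is bounded by the variation. *)
Lemma pow_nln_prim_approx n j a b : 0 <= a -> a <= b -> b <= 1 ->
  `|pow_nln_prim n.+1 j b - pow_nln_prim n.+1 j a - pow_nln n.+1 j a * (b - a)|
    <= (pow_nln_var n j b - pow_nln_var n j a) * (b - a).
Proof.
move=> a0 ab b1; move: a0; rewrite le_eqVlt => /orP[/eqP a0|a0].
  rewrite -a0 pow_nln_prim0 pow_nln_var0 !subr0 /pow_nln expr0n /= !mul0r subr0 in ab *.
  have b01 : 0 <= b <= 1 by rewrite ab b1.
  rewrite ger0_norm ?pow_nln_prim_ge0 // mulrC; apply: le_trans (pow_nln_prim_le n j b01) _.
  have b0 : 0 <= b by case/andP: b01.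
  apply: ler_wpM2l => //; rewrite /pow_nln_var.
  apply: le_trans (_ : n.+1%:R * pow_nln_prim n j b <= _).
    by rewrite ler_peMl ?pow_nln_prim_ge0 // ler1n.
  by rewrite lerDl mulr_ge0 // pow_nln_prim_ge0.
move: ab; rewrite le_eqVlt => /orP[/eqP <-|ab]; first by rewrite !subrr !mulr0 subrr normr0.
have [c /andP[ac cb] ->] := pow_nln_prim_mvt n.+1 j a0 ab.
rewrite -mulrBl normrM (gtr0_norm (_ : 0 < b - a)) ?subr_gt0 //.
apply: ler_wpM2r; first lra.
apply: le_trans (pow_nln_variation _ _ _ _ _) _; try lra.
by rewrite lerD2r pow_nln_var_homo //; lra.
Qed.

(** Abel summation in v = log p with w = 1 - v / u. Since w decreases in v, the primitive and the
    variation carry a minus sign. The exponent n + 1 >= 1 makes the boundary term at w = 0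
    vanish. *)
Lemma prime_sum_pow_nln y n j : 1 < y ->
  `|prime_sum (Num.truncn y) (fun p => ln p%:R / p%:R * pow_nln n.+1 j (1 - ln p%:R / ln y))
     - ln y * (j`!%:R / n.+2%:R ^+ j.+1)| <= 18 * (j`!%:R / n.+1%:R ^+ j).
Proof.
move=> y1; have u0 : 0 < ln y by rewrite ln_gt0.
set u := ln y.
have := @prime_sum_ln_approx R 1 y (fun v => pow_nln n.+1 j (1 - v / u))
  (fun v => - (u * pow_nln_prim n.+1 j (1 - v / u))) (fun v => - pow_nln_var n j (1 - v / u)) isT.
have -> : prime_sum 1 (fun p => ln p%:R / p%:R * pow_nln n.+1 j (1 - ln p%:R / u)) = 0.
  by rewrite prime_sumS prime_sum0 addr0.
have W v : 0 <= v -> v <= u -> 0 <= 1 - v / u <= 1.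
  move=> v0 vu; have : v / u <= 1 by rewrite ler_pdivrMr // mul1r.
  have : 0 <= v / u by rewrite divr_ge0 // ltW.
  lra.
have Wm a b : a <= b -> 1 - b / u <= 1 - a / u.
  by move=> ab; rewrite lerD2l lerN2 ler_pM2r // invr_gt0.
rewrite ln1 -/u divff ?lt0r_neq0 // subrr mul0r !subr0 pow_nln_prim0 pow_nln_prim1 pow_nln_var0 oppr0 mulr0 oppr0 !sub0r !opprK.
move=> H; have {H} := H (ltW y1).
move=> H; have {H} := H _ _ => H; apply: le_trans (H _ _) _.
- move=> a b a0 ab bu; rewrite distrC opprK (addrC (- pow_nln_var _ _ _)).
  have /andP[? ?] := W a a0 (le_trans ab bu).
  have /andP[? ?] := W b (le_trans a0 ab) bu.
  exact: (pow_nln_variation n j _ (Wm _ _ ab) _).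
- move=> a b a0 ab bu.
  have /andP[? ?] := W a a0 (le_trans ab bu).
  have /andP[? ?] := W b (le_trans a0 ab) bu.
  have := @pow_nln_prim_approx n j (1 - b / u) (1 - a / u).
  have -> : 1 - a / u - (1 - b / u) = (b - a) / u by rewrite mulrBl; ring.
  set A := pow_nln_prim _ _ (1 - a / u); set B := pow_nln_prim _ _ (1 - b / u).
  move=> /(_ _ (Wm _ _ ab) _) h.
  have {h} h : `|A - B - pow_nln n.+1 j (1 - b / u) * ((b - a) / u)| <=
     (pow_nln_var n j (1 - a / u) - pow_nln_var n j (1 - b / u)) * ((b - a) / u) by exact: h.
  have -> : - (u * B) - - (u * A) - pow_nln n.+1 j (1 - b / u) * (b - a) =
     u * (A - B - pow_nln n.+1 j (1 - b / u) * ((b - a) / u)).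
    by field; rewrite lt0r_neq0.
  rewrite normrM gtr0_norm // -(ler_pM2l u0) in h *.
  apply: le_trans h _; rewrite le_eqVlt; apply/orP; left; apply/eqP.
  by rewrite -/u; field; rewrite lt0r_neq0.
have h1 : `|pow_nln n.+1 j 0| = 0 :> R by rewrite /pow_nln expr0n mul0r normr0.
have f0 : 0 <= j`!%:R / n.+1%:R ^+ j :> R by rewrite divr_ge0 // exprn_ge0.
have h2 : `|pow_nln n.+1 j 1| <= j`!%:R / n.+1%:R ^+ j :> R.
  rewrite /pow_nln expr1n ln1 oppr0 mul1r; case: j f0 {H h1} => [|i] f0; first by rewrite fact0 !expr0 normr1 divr1.
  by rewrite expr0n normr0.
have h3 := pow_nln_var1_le n j.
rewrite -mulrA in h3; lra.
Qed.
End LogMoments.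

(** * The moments of w log^i w / (1 - w) and the values of zeta *)

Section ZetaMoments.
Variable R : realType.
Implicit Types (x y : R).

Lemma sum_inv_pow_le n (M N : nat) : (1 < n)%N -> (0 < M)%N -> (M <= N)%N ->
  \sum_(M <= m < N) (m.+1%:R ^+ n)^-1 <= M%:R^-1 - N%:R^-1 :> R.
Proof.
move=> n1 M0; elim: N => [|N IH]; first by case: M M0.
rewrite leq_eqVlt => /orP[/eqP <-|MN]; first by rewrite big_geq // subrr.
rewrite big_nat_recr //=; have {}IH := IH MN.
have N0 : (0 < N)%N := leq_trans M0 MN.
suff h : (N.+1%:R ^+ n)^-1 <= N%:R^-1 - N.+1%:R^-1 :> R.
  by apply: le_trans (lerD IH h) _; rewrite addrA subrK.
have NR : 0 < N%:R :> R by rewrite ltr0n.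
have -> : N%:R^-1 - N.+1%:R^-1 = (N%:R * N.+1%:R)^-1 :> R.
  by rewrite -natr1; field; apply/andP; split; apply: lt0r_neq0; lra.
rewrite lef_pV2 ?posrE ?exprn_gt0 ?mulr_gt0 ?ltr0n //.
apply: le_trans (_ : N.+1%:R ^+ 2 <= _); last by rewrite ler_eXn2l // ltr1n.
by rewrite expr2 ler_pM2r ?ltr0n // ler_nat.
Qed.

(** [zeta] is a [limn]: the partial sums converge, being nondecreasing and bounded by a telescoping
    estimate, and that estimate then passes to the limit. *)
Lemma zeta_tail n (N : nat) : (1 < n)%N -> (0 < N)%N ->
  0 <= zeta R n - \sum_(0 <= m < N) (m.+1%:R ^+ n)^-1 <= N%:R^-1.
Proof.
move=> n1 N0; pose u := fun m : nat => (m.+1%:R ^+ n)^-1 : R.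
have u0 m : 0 <= u m by rewrite invr_ge0 exprn_ge0.
have ser k : series u k = \sum_(0 <= m < k) u m by [].
have inc : nondecreasing_seq (series u).
  move=> a b ab; rewrite !ser [leRHS](big_cat_nat (n := a)) //= lerDl.
  exact: sumr_ge0.
have bnd M k : (0 < M)%N -> (M <= k)%N -> series u k <= series u M + M%:R^-1.
  move=> M0 Mk; rewrite !ser [leLHS](big_cat_nat (n := M)) //= lerD2l.
  apply: le_trans (sum_inv_pow_le n1 M0 Mk) _.
  by rewrite lerBlDr lerDl invr_ge0.
have cv : cvgn (series u).
  apply: nondecreasing_is_cvgn => //; exists (series u 1 + 1%:R^-1) => _ [k _ <-].
  case: k => [|k]; last exact: bnd.
  by rewrite !ser big_geq // addr_ge0 // big_nat1.
rewrite /zeta -/u -ser subr_ge0; apply/andP; split.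
  exact: nondecreasing_cvgn_le.
rewrite lerBlDl; apply: limr_le => //.
near=> k; apply: bnd => //; near: k; exact: nbhs_infty_ge.
Unshelve. all: by end_near.
Qed.

Lemma harmonic_le N : \sum_(n < N.+1) n.+1%:R^-1 <= 1 + ln N.+1%:R :> R.
Proof.
elim: N => [|N IH]; first by rewrite big_ord1 ln1 addr0 invr1.
rewrite big_ord_recr /=.
have le : N.+1%:R <= N.+2%:R :> R by rewrite ler_nat.
have /andP[h _] := ln_sub_bounds (ltr0Sn R N) le.
have E : N.+2%:R - N.+1%:R = 1 :> R by rewrite -(natr1 N.+1); ring.
by rewrite E mul1r in h; apply: le_trans (lerD IH h) _; lra.
Qed.

(** The remainder of the geometric series is w^(N+1) (-log w)^(i+1) / (1 - w); the inequality w
    (-log w) <= 1 - w trades one logarithm for the singular denominator. *)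
Lemma pow_nln_geometric (N i : nat) (w : R) : 0 <= w < 1 ->
  exists2 r, 0 <= r <= pow_nln N i w &
  pow_nln 1 i.+1 w / (1 - w) = \sum_(n < N) pow_nln n.+1 i.+1 w + r.
Proof.
move=> /andP[w0 w1].
have w1' : 1 - w != 0 by apply: lt0r_neq0; lra.
exists (pow_nln N.+1 i.+1 w / (1 - w)).
  have k0 m j : 0 <= pow_nln m j w by apply: pow_nln_ge0; lra.
  rewrite divr_ge0 //=; last lra.
  rewrite ler_pdivrMr; last lra.
  move: w0; rewrite le_eqVlt => /orP[/eqP <-|w0].
    by rewrite {1}/pow_nln exprS !mul0r subr0 mulr1 pow_nln_ge0 // lexx ler01.
  have -> : pow_nln N.+1 i.+1 w = pow_nln N i w * (w * - ln w).
    by rewrite /pow_nln !exprSr; ring.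
  apply: ler_wpM2l => //.
  have : - ln w <= w^-1 - 1 by rewrite -lnV ?posrE //; apply: ln_le_subr1; rewrite invr_gt0.
  rewrite -(ler_pM2l w0) mulrBr divff ?lt0r_neq0 //; lra.
elim: N => [|N ->]; first by rewrite big_ord0 add0r.
rewrite big_ord_recr /= -addrA; congr (_ + _).
have -> : pow_nln N.+2 i.+1 w = w * pow_nln N.+1 i.+1 w by rewrite /pow_nln !exprS; ring.
by field.
Qed.

(** With w = 1 - log p / u one has u / p = (log p / p) / (1 - w), so expanding 1 / (1 - w) reduces
    the sum to [prime_sum_pow_nln] for each exponent. *)
Lemma prime_sum_pow_nln1 i y : 1 <= ln (ln y) ->
  `|ln y * prime_sum (Num.truncn y) (fun p => p%:R^-1 * pow_nln 1 i.+1 (1 - ln p%:R / ln y))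
    - ln y * (i.+1`!%:R * (zeta R i.+2 - 1))| <= 74 * i.+1`!%:R * ln (ln y).
Proof.
set u := ln y => v1.
have u1 : 1 < u.
  rewrite ltNge; apply/negP => u1; have := ln_le0 u1; lra.
have u0 : 0 < u by lra.
have y1 : 1 < y.
  rewrite ltNge; apply/negP => y1; have := ln_le0 y1; rewrite -/u; lra.
set v := ln u in v1 *.
(* About u terms of the geometric series are kept: then u times the tail of zeta is bounded, and the
   errors of the terms, of size 1 / (n + 1), add up to O(log u). *)
pose N := Num.truncn u.
have N0 : (0 < N)%N by rewrite truncn_gt0 ltW.
have /andP[Nu uN] := truncn_itv (ltW u0).
pose W (p : nat) : R := 1 - ln p%:R / u.
have HW (p : nat) : prime p -> (p <= Num.truncn y)%N -> 0 <= W p < 1.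
  move=> pp; rewrite truncn_ge_nat; last lra.
  move=> py; have lp : 0 < ln p%:R :> R by rewrite ln_gt0 // ltr1n prime_gt1.
  have : ln p%:R <= u by rewrite ler_ln ?posrE ?ltr0n ?prime_gt0 //; lra.
  rewrite /W => h.
  have : ln p%:R / u <= 1 by rewrite ler_pdivrMr // mul1r.
  have : 0 < ln p%:R / u by rewrite divr_gt0.
  lra.
pose X n := prime_sum (Num.truncn y) (fun p => ln p%:R / p%:R * pow_nln n.+1 i.+1 (W p)).
pose Y := prime_sum (Num.truncn y) (fun p => ln p%:R / p%:R * pow_nln N.+1 i (W p)).
have Y0 : 0 <= Y.
  apply: prime_sum_ge0 => p pp py; rewrite mulr_ge0 ?divr_ge0 ?ln_nat_ge0 // pow_nln_ge0 //.
  by have := HW p pp py; lra.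
have [r /andP[r0 rY] ->] : exists2 r, 0 <= r <= Y &
  u * prime_sum (Num.truncn y) (fun p => p%:R^-1 * pow_nln 1 i.+1 (W p)) = \sum_(n < N.+1) X n + r.
  exists (u * prime_sum (Num.truncn y) (fun p => p%:R^-1 * pow_nln 1 i.+1 (W p)) - \sum_(n < N.+1) X n);
    last by ring.
  have -> : \sum_(n < N.+1) X n = prime_sum (Num.truncn y) (fun p => ln p%:R / p%:R *
      \sum_(n < N.+1) pow_nln n.+1 i.+1 (W p)).
    rewrite /X /prime_sum exchange_big /=; apply: eq_bigr => p _.
    by rewrite mulr_sumr.
  rewrite -prime_sumZ -prime_sumB.
  have H (p : nat) : prime p -> (p <= Num.truncn y)%N -> 0 <= u * (p%:R^-1 * pow_nln 1 i.+1 (W p)) -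
     ln p%:R / p%:R * \sum_(n < N.+1) pow_nln n.+1 i.+1 (W p) <= ln p%:R / p%:R * pow_nln N.+1 i (W p).
    move=> pp py; have hw := HW p pp py.
    have lp : 0 < ln p%:R :> R by rewrite ln_gt0 // ltr1n prime_gt1.
    have p0 : 0 < p%:R :> R by rewrite ltr0n prime_gt0.
    have [r /andP[r0 r1] E] := @pow_nln_geometric N.+1 i (W p) hw.
    have -> : u * (p%:R^-1 * pow_nln 1 i.+1 (W p)) = ln p%:R / p%:R * (pow_nln 1 i.+1 (W p) / (1 - W p)).
      rewrite /W opprB addrCA subrr addr0.
      by field; rewrite !lt0r_neq0.
    rewrite E mulrDr addrAC subrr add0r mulr_ge0 ?divr_ge0 // ?ler_wpM2l ?divr_ge0 //; lra.
  apply/andP; split.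
    by apply: prime_sum_ge0 => p pp py; have /andP[] := H p pp py.
  by apply: ler_prime_sum => p pp py; have /andP[] := H p pp py.
set f := i.+1`!%:R.
have f1 : 1 <= f by rewrite ler1n fact_gt0.
have fi : i`!%:R <= f :> R by rewrite ler_nat factS leq_pmull.
have NR : 1 <= N%:R :> R by rewrite ler1n.
have YB : Y <= 19 * f.
  have := prime_sum_pow_nln N i y1; rewrite -/u -/Y ler_distl => /andP[_ h].
  apply: le_trans h _.
  have h1 : u * (i`!%:R / N.+2%:R ^+ i.+1) <= f.
    rewrite mulrA ler_pdivrMr ?exprn_gt0 ?ltr0n // mulrC.
    apply: ler_pM => //; [lra|].
    apply: le_trans (ltW uN) _; apply: le_trans (_ : N.+2%:R <= _); first by rewrite ler_nat.
    by rewrite exprS ler_peMr // exprn_ege1 // ler1n.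
  have h2 : i`!%:R / N.+1%:R ^+ i <= f.
    apply: le_trans fi; rewrite ler_pdivrMr ?exprn_gt0 ?ltr0n // ler_peMr //.
    by rewrite exprn_ege1 // ler1n.
  lra.
have XB : `|\sum_(n < N.+1) X n - u * \sum_(n < N.+1) f / n.+2%:R ^+ i.+2| <= 18 * f * (1 + ln N.+1%:R).
  rewrite mulr_sumr -sumrB; apply: le_trans (ler_norm_sum _ _ _) _.
  apply: le_trans (_ : \sum_(n < N.+1) 18 * f * n.+1%:R^-1 <= _); last first.
    by rewrite -mulr_sumr ler_wpM2l ?harmonic_le //; lra.
  apply: ler_sum => n _; apply: le_trans (prime_sum_pow_nln n i.+1 y1) _.
  rewrite -mulrA ler_pM2l //; apply: ler_wpM2l; first lra.
  by rewrite lef_pV2 ?posrE ?exprn_gt0 ?ltr0n // exprS ler_peMr // exprn_ege1 // ler1n.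
(* The moments have denominators from 2 on, hence zeta without its first term 1. *)
have ZB : `|u * \sum_(n < N.+1) f / n.+2%:R ^+ i.+2 - u * (f * (zeta R i.+2 - 1))| <= f.
  have /andP[z0 z1] := @zeta_tail i.+2 N.+2 isT isT.
  have -> : u * \sum_(n < N.+1) f / n.+2%:R ^+ i.+2 - u * (f * (zeta R i.+2 - 1)) =
    - (u * (f * (zeta R i.+2 - \sum_(0 <= m < N.+2) (m.+1%:R ^+ i.+2)^-1))).
    rewrite big_ltn // expr1n invr1 big_add1 /= big_mkord -mulr_sumr; ring.
  rewrite normrN ger0_norm; last by rewrite !mulr_ge0 //; lra.
  rewrite mulrCA ger_pMr; last lra.
  apply: le_trans (_ : u * N.+2%:R^-1 <= _); first by rewrite ler_pM2l.
  rewrite ler_pdivrMr ?ltr0n // mul1r; apply: le_trans (ltW uN) _.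
  by rewrite ler_nat.
have lN : ln N.+1%:R <= 1 + v.
  apply: le_trans (_ : ln (2 * u) <= _).
    rewrite ler_ln ?posrE ?ltr0n ?mulr_gt0 // -natr1; lra.
  rewrite lnM ?posrE // -/v lerD2r; apply: le_trans (ln_le_subr1 _) _; lra.
have fl : f * (1 + ln N.+1%:R) <= f * (2 + v) by rewrite ler_pM2l; lra.
have fv : f <= f * v by rewrite ler_peMr; lra.
set A := \sum_(n < N.+1) X n in XB *; set B := u * \sum_(n < _) _ in XB ZB.
(* In units of f v, with v >= 1, the three errors are at most 54, from 18 (2 + v) <= 54 v, then 19
   and 1, which makes 74. *)
have -> : A + r - u * (f * (zeta R i.+2 - 1)) = (A - B) + r + (B - u * (f * (zeta R i.+2 - 1))) by ring.
apply: le_trans (ler_normD _ _) _.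
have := ler_normD (A - B) r; rewrite (ger0_norm r0); lra.
Qed.

(** Here w / (1 - w) is not integrable at w = 1, so the sum is split into those of 1 / p and log p /
    p; Mertens' second theorem contributes 52 and the first 4. *)
Lemma prime_sum_pow_nln0 y : 2 <= y ->
  `|ln y * prime_sum (Num.truncn y) (fun p => p%:R^-1 * (1 - ln p%:R / ln y))
    - ln y * (ln (ln y) + mertensB R - 1)| <= 56.
Proof.
move=> y2; have u0 : 0 < ln y by rewrite ln_gt0; lra.
have h1 := mertens_second y2.
have h2 : `|mertens_rem y| <= 4 by apply: mertens_rem_le; lra.
have -> : prime_sum (Num.truncn y) (fun p => p%:R^-1 * (1 - ln p%:R / ln y)) =
    prime_inv y - (ln y)^-1 * mertensA R (Num.truncn y).
  rewrite /prime_inv /mertensA -prime_sumZ -prime_sumB; apply: eq_prime_sum => p pp _.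
  by ring.
have -> : ln y * (prime_inv y - (ln y)^-1 * mertensA R (Num.truncn y)) -
    ln y * (ln (ln y) + mertensB R - 1) =
    ln y * (prime_inv y - ln (ln y) - mertensB R) - mertens_rem y.
  by rewrite /mertens_rem; field; rewrite lt0r_neq0.
apply: le_trans (ler_normB _ _) _; rewrite normrM (gtr0_norm u0).
have : ln y * `|prime_inv y - ln (ln y) - mertensB R| <= 52.
  by rewrite mulrC -ler_pdivlMr.
lra.
Qed.
End ZetaMoments.

(** * The effect of summing over one more prime *)

Section PrimeConvolution.
Variable R : realType.
Implicit Types (q : {poly R}) (x y v : R) (i d K : nat).

(** The argument is already a logarithm: [Psi q (ln x)] is log x times q(log log x). *)
Definition Psi q x : R := x * q.[ln x].

(* The coefficient of q^`(i) is the integral of w log^i w / (1 - w) over [0, 1],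
   divided by i!. *)
Definition conv_op K q : {poly R} :=
  ('X + (mertensB R - 1)%:P) * q
  + \sum_(1 <= i < K) ((-1) ^+ i * (zeta R i.+1 - 1)) *: q^`(i).

Lemma horner_bound q d : (size q <= d.+1)%N ->
  exists2 C : R, 0 <= C & forall v, 1 <= v -> `|q.[v]| <= C * v ^+ d.
Proof.
move=> sq; exists (\sum_(i < size q) `|q`_i|); first exact: sumr_ge0.
move=> v v1; rewrite horner_coef mulr_suml; apply: le_trans (ler_norm_sum _ _ _) _.
apply: ler_sum => i _; rewrite normrM; apply: ler_wpM2l => //.
rewrite normrX ger0_norm; last lra.
by rewrite ler_weXn2l // -ltnS (leq_trans (ltn_ord i)).
Qed.

Lemma size_nderivn_le q i : (size q^`N(i) <= size q)%N.
Proof.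
apply/leq_sizeP => j sj; rewrite coef_nderivn nth_default ?mul0rn //.
by rewrite (leq_trans sj) // leq_addl.
Qed.

Lemma uniform_bound (I : finType) (P : I -> R -> Prop) :
  (forall i : I, exists2 C : R, 0 <= C & P i C) ->
  (forall (i : I) (C C' : R), C <= C' -> P i C -> P i C') ->
  exists2 C : R, 0 <= C & forall i : I, P i C.
Proof.
move=> H mono.
have /choice[f Hf] : forall i : I, exists C : R, 0 <= C /\ P i C.
  by move=> i; have [C] := H i; exists C.
exists (\sum_i f i); first by apply: sumr_ge0 => i _; have [] := Hf i.
move=> i; have [fi Pi] := Hf i; apply: mono Pi.
rewrite (bigD1 i) //= lerDl; apply: sumr_ge0 => j _; by have [] := Hf j.
Qed.

Lemma prime_sum_wln i y : 1 <= ln (ln y) ->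
  `|ln y * prime_sum (Num.truncn y) (fun p => p%:R^-1 *
        ((1 - ln p%:R / ln y) * ln (1 - ln p%:R / ln y) ^+ i))
    - ln y * (if i is 0 then ln (ln y) + mertensB R - 1
              else (-1) ^+ i * (i`!%:R * (zeta R i.+1 - 1)))|
  <= 74 * i`!%:R * ln (ln y).
Proof.
move=> v1; case: i => [|i].
  have y2 : 2 <= y.
    have : 0 < ln y.
      by rewrite ltNge; apply/negP => h; move: v1; rewrite ln0 //; lra.
    move=> u0; have h1 := ln_le_subr1 u0.
    have y0 : 0 < y by rewrite ltNge; apply/negP => h; move: u0; rewrite ln0 //; lra.
    have := ln_le_subr1 y0; lra.
  have := prime_sum_pow_nln0 y2.
  have -> : prime_sum (Num.truncn y) (fun p => p%:R^-1 * (1 - ln p%:R / ln y)) =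
    prime_sum (Num.truncn y) (fun p => p%:R^-1 *
        ((1 - ln p%:R / ln y) * ln (1 - ln p%:R / ln y) ^+ 0)).
    by apply: eq_prime_sum => p _ _; rewrite expr0 mulr1.
  rewrite fact0; lra.
have := @prime_sum_pow_nln1 R i y v1.
have -> : prime_sum (Num.truncn y) (fun p => p%:R^-1 *
        ((1 - ln p%:R / ln y) * ln (1 - ln p%:R / ln y) ^+ i.+1)) =
   (-1) ^+ i.+1 * prime_sum (Num.truncn y) (fun p => p%:R^-1 * pow_nln 1 i.+1 (1 - ln p%:R / ln y)).
  rewrite -prime_sumZ; apply: eq_prime_sum => p _ _; rewrite /pow_nln expr1 (exprNn (ln _)).
  have e2 : (-1) ^+ i.+1 * (-1) ^+ i.+1 = 1 :> R by rewrite -exprMn mulrNN mulr1 expr1n.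
  set c := ln _ ^+ _; set e := (-1) ^+ _ in e2 *.
  by rewrite -[LHS]mul1r -e2; ring.
set A := prime_sum _ _; set B := _ * (_ - 1).
rewrite !(mulrCA (ln y)) -mulrBr normrM normrX normrN1 expr1n mul1r; exact.
Qed.

(** As log y - log p = u W(p), the polynomial is taken at log u + log W(p). Its Taylor expansion at
    v = log u ends before order K, and each coefficient multiplies a moment evaluated by
    [prime_sum_wln]. *)
Lemma prime_sum_Psi K d q : (size q <= d.+1)%N -> (d < K)%N ->
  exists2 C : R, 0 <= C & forall y, 1 <= ln (ln y) ->
    `|prime_sum (Num.truncn y) (fun p => p%:R^-1 * Psi q (ln y - ln p%:R)) - Psi (conv_op K q) (ln y)|
      <= C * ln (ln y) ^+ d.+1.
Proof.
move=> sq dK.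
have sN i : (size q^`N(i) <= d.+1)%N by apply: leq_trans sq; exact: size_nderivn_le.
have [c c0 Hc] : exists2 C : R, 0 <= C &
    forall i : 'I_K, forall v, 1 <= v -> `|q^`N(i).[v]| <= C * v ^+ d.
  apply: (@uniform_bound _ (fun (i : 'I_K) C => forall v, 1 <= v -> `|q^`N(i).[v]| <= C * v ^+ d)).
    by move=> i; exact: horner_bound.
  move=> i C C' CC' h v v1; apply: le_trans (h v v1) _.
  by apply: ler_wpM2r => //; rewrite exprn_ge0 //; lra.
exists (\sum_(i < K) c * (74 * i`!%:R)).
  by apply: sumr_ge0 => i _; rewrite !mulr_ge0.
move=> y; set u := ln y; set v := ln u => v1.
have u0 : 0 < u by rewrite ltNge; apply/negP => h; move: v1; rewrite /v ln0 //; lra.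
have y0 : 0 < y by rewrite ltNge; apply/negP => h; move: u0; rewrite /u ln0 //; lra.
pose W (p : nat) : R := 1 - ln p%:R / u.
pose mo i : R := if i is 0 then v + mertensB R - 1 else (-1) ^+ i * (i`!%:R * (zeta R i.+1 - 1)).
have -> : prime_sum (Num.truncn y) (fun p => p%:R^-1 * Psi q (u - ln p%:R)) =
    \sum_(i < K) q^`N(i).[v] * (u * prime_sum (Num.truncn y) (fun p => p%:R^-1 * (W p * ln (W p) ^+ i))).
  transitivity (prime_sum (Num.truncn y) (fun p => \sum_(i < K) q^`N(i).[v] * u * (p%:R^-1 * (W p * ln (W p) ^+ i)))).
    apply: eq_prime_sum => p pp; rewrite truncn_ge_nat; last exact: ltW.
    move=> py; have lp : ln p%:R <= u by rewrite ler_ln ?posrE ?ltr0n ?prime_gt0.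
    have E : u - ln p%:R = u * W p by rewrite /W; field; rewrite lt0r_neq0.
    have W0 : 0 <= W p.
      by rewrite -(pmulr_rge0 _ u0) -E subr_ge0.
    (* When W(p) = 0 the logarithm does not split, but both sides vanish through the factor W(p). *)
    move: W0; rewrite le_eqVlt => /orP[/eqP W0|W0].
      rewrite E -W0 /Psi mulr0 mul0r mulr0 big1 // => i _.
      by rewrite mul0r !mulr0.
    rewrite E /Psi lnM ?posrE // (@nderiv_taylor_wide _ K); [|exact: mulrC|exact: leq_trans dK].
    rewrite !mulr_sumr; apply: eq_bigr => i _; rewrite -/v; ring.
  rewrite /prime_sum exchange_big /=; apply: eq_bigr => i _.
  by rewrite mulrA mulr_sumr.
have -> : Psi (conv_op K q) u = \sum_(i < K) q^`N(i).[v] * (u * mo i).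
  case: K dK {c c0 Hc} => // K dK.
  rewrite /Psi /conv_op -/v hornerD hornerM hornerD hornerX hornerC horner_sum.
  rewrite big_ord_recl /= nderivn0 mulrDr addrA mulrCA; congr (_ + _).
    by ring.
  rewrite big_add1 /= big_mkord mulr_sumr; apply: eq_bigr => i _.
  rewrite -derivnS hornerZ nderivn_def hornerMn /bump add1n -[_ *+ _]mulr_natr.
  by ring.
rewrite -sumrB mulr_suml; apply: le_trans (ler_norm_sum _ _ _) _.
apply: ler_sum => i _; rewrite -mulrBr normrM.
have -> : c * (74 * i`!%:R) * v ^+ d.+1 = (c * v ^+ d) * (74 * i`!%:R * v).
  by rewrite exprSr; ring.
apply: ler_pM => //; first exact: Hc.
by have := @prime_sum_wln i y v1.
Qed.

(** Near 0 the logarithm is unbounded but x log^i x is not, and on [1, e] the logarithm lies in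
    [0, 1]. This serves where log log is below 1 and [prime_sum_Psi] does not apply. *)
Lemma Psi_small q : exists2 C : R, 0 <= C &
  forall x, 0 <= x <= expR 1 -> `|Psi q x| <= C.
Proof.
exists (\sum_(i < size q) `|q`_i| * (2 * i`!%:R + expR 1)).
  by apply: sumr_ge0 => i _; rewrite mulr_ge0 // addr_ge0 ?mulr_ge0 ?expR_ge0.
move=> x /andP[x0 xe]; rewrite /Psi horner_coef mulr_sumr.
apply: le_trans (ler_norm_sum _ _ _) _; apply: ler_sum => i _.
rewrite mulrCA normrM; apply: ler_wpM2l => //.
have e0 := expR_ge0 (1 : R).
have f0 : 0 <= i`!%:R :> R by [].
have [x1|x1] := leP x 1.
  have x01 : 0 <= x <= 1 by rewrite x0.
  have h : pow_nln 1 i x <= 2 * i`!%:R.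
    have := @pow_nln_variation R 0 i 0 x (lexx 0) x0 x1.
    rewrite pow_nln_var0 subr0 {2}/pow_nln expr1 mul0r subr0 => h.
    apply: le_trans (ler_norm _) _; apply: le_trans h _.
    apply: le_trans (@pow_nln_var_homo R 0 i x 1 x0 x1 (lexx 1)) _.
    by apply: le_trans (pow_nln_var1_le _ _ _) _; rewrite expr1n divr1.
  have -> : `|x * ln x ^+ i| = pow_nln 1 i x.
    rewrite normrM normrX (ger0_norm x0) ler0_norm ?ln_le0 //.
  lra.
have l0 : 0 <= ln x by apply: ln_ge0; lra.
have l1 : ln x <= 1 by rewrite -(expRK 1) ler_ln ?posrE ?expR_gt0 //; lra.
have h : x * ln x ^+ i <= expR 1.
  rewrite -[leRHS]mulr1; apply: ler_pM; rewrite ?exprn_ge0 //.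
  by rewrite exprn_ile1.
rewrite ger0_norm ?mulr_ge0 ?exprn_ge0 //; lra.
Qed.
End PrimeConvolution.

(** * Weighted sums over k-tuples of primes and their recursions *)

Section TupleSums.
Variable R : realType.
Variable N : nat.
Implicit Types (h : nat -> R) (x y : R) (k s n : nat).

Lemma prime_sum_widen (M : nat) h : (M <= N)%N ->
  (forall p, prime p -> (M < p <= N)%N -> h p = 0) -> prime_sum N h = prime_sum M h.
Proof.
move=> MN h0; rewrite /prime_sum (big_cat_nat (n := M.+1)) //= [X in _ + X]big_nat_cond.
by rewrite [X in _ + X]big1 ?addr0 // => p /andP[pN pp]; exact: h0.
Qed.

(* Sum of h (p_1 ... p_k) / (p_1 ... p_k) over the primes p_i <= N; the
   condition p_1 ... p_k <= x is put into h. *)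
Fixpoint tuple_sum k h : R :=
  if k is k'.+1 then prime_sum N (fun p => p%:R^-1 * tuple_sum k' (fun n => h (p * n)%N)) else h 1%N.

Lemma eq_tuple_sum k h h' : (forall n, (0 < n)%N -> h n = h' n) -> tuple_sum k h = tuple_sum k h'.
Proof.
elim: k h h' => [|k IH] h h' hh /=; first exact: hh.
by apply: eq_prime_sum => p pp _; congr (_ * _); apply: IH => n n0; rewrite hh // muln_gt0 prime_gt0.
Qed.

Lemma ler_tuple_sum k h h' : (forall n, (0 < n)%N -> h n <= h' n) -> tuple_sum k h <= tuple_sum k h'.
Proof.
elim: k h h' => [|k IH] h h' hh /=; first exact: hh.
apply: ler_prime_sum => p pp _; apply: ler_wpM2l; first by rewrite invr_ge0.
by apply: IH => n n0; rewrite hh // muln_gt0 prime_gt0.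
Qed.

Lemma tuple_sumD k h h' : tuple_sum k (fun n => h n + h' n) = tuple_sum k h + tuple_sum k h'.
Proof.
elim: k h h' => [|k IH] h h' //=; rewrite -prime_sumD.
by apply: eq_prime_sum => p _ _; rewrite IH mulrDr.
Qed.

Lemma tuple_sumZ k (c : R) h : tuple_sum k (fun n => c * h n) = c * tuple_sum k h.
Proof.
elim: k h => [|k IH] h //=; rewrite -prime_sumZ.
by apply: eq_prime_sum => p _ _; rewrite IH mulrCA.
Qed.

Lemma tuple_sumB k h h' : tuple_sum k (fun n => h n - h' n) = tuple_sum k h - tuple_sum k h'.
Proof.
rewrite -mulN1r -tuple_sumZ -tuple_sumD; apply: eq_tuple_sum => n _; by rewrite mulN1r.
Qed.

Lemma tuple_sum0 k : tuple_sum k (fun=> 0) = 0.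
Proof.
transitivity (0 * tuple_sum k (fun=> 0)); last by rewrite mul0r.
by rewrite -tuple_sumZ; apply: eq_tuple_sum => n _; rewrite mul0r.
Qed.

Lemma tuple_sum_prime_sum k (c : nat -> R) (H : nat -> nat -> R) :
  tuple_sum k (fun n => prime_sum N (fun p => c p * H p n)) = prime_sum N (fun p => c p * tuple_sum k (H p)).
Proof.
elim: k H => [|k IH] H //=.
transitivity (prime_sum N (fun q => prime_sum N (fun p => c p * (q%:R^-1 * tuple_sum k (fun n => H p (q * n)%N))))).
  apply: eq_prime_sum => q _ _; rewrite (IH (fun p n => H p (q * n)%N)) -prime_sumZ.
  by apply: eq_prime_sum => p _ _; rewrite mulrCA.
rewrite /prime_sum exchange_big /=; apply: eq_bigr => p _; by rewrite mulr_sumr.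
Qed.

Lemma ler_norm_tuple_sum k h : `|tuple_sum k h| <= tuple_sum k (fun n => `|h n|).
Proof.
elim: k h => [|k IH] h //=; apply: le_trans (ler_norm_prime_sum _ _) _.
apply: ler_prime_sum => p _ _; rewrite normrM ger0_norm ?invr_ge0 //.
by apply: ler_wpM2l; rewrite ?invr_ge0.
Qed.

(* log (p_1 ... p_k) is a sum of k terms which contribute equally. *)
Lemma tuple_sum_ln k h :
  tuple_sum k.+1 (fun n => h n * ln n%:R) =
  k.+1%:R * prime_sum N (fun p => ln p%:R / p%:R * tuple_sum k (fun n => h (p * n)%N)).
Proof.
elim: k h => [|k IH] h.
  by rewrite /= mul1r; apply: eq_prime_sum => p _ _; rewrite muln1; ring.
have -> : tuple_sum k.+2 (fun n => h n * ln n%:R) =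
   prime_sum N (fun p => ln p%:R / p%:R * tuple_sum k.+1 (fun n => h (p * n)%N)) +
   prime_sum N (fun p => p%:R^-1 * tuple_sum k.+1 (fun n => h (p * n)%N * ln n%:R)).
  rewrite -prime_sumD; transitivity (prime_sum N (fun p => p%:R^-1 *
    tuple_sum k.+1 (fun n => h (p * n)%N * ln (p * n)%:R))); first by [].
  apply: eq_prime_sum => p pp _.
  have -> : tuple_sum k.+1 (fun n => h (p * n)%N * ln (p * n)%:R) =
     ln p%:R * tuple_sum k.+1 (fun n => h (p * n)%N) + tuple_sum k.+1 (fun n => h (p * n)%N * ln n%:R).
    rewrite -tuple_sumZ -tuple_sumD; apply: eq_tuple_sum => n n0.
    by rewrite (ln_natM R (prime_gt0 pp) n0) mulrDr (mulrC (ln p%:R)).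
  by rewrite mulrDr mulrA (mulrC p%:R^-1).
have -> : prime_sum N (fun p => p%:R^-1 * tuple_sum k.+1 (fun n => h (p * n)%N * ln n%:R)) =
   k.+1%:R * prime_sum N (fun p => ln p%:R / p%:R * tuple_sum k.+1 (fun n => h (p * n)%N)).
  transitivity (prime_sum N (fun p => prime_sum N (fun q => k.+1%:R * (ln q%:R / q%:R * (p%:R^-1 *
      tuple_sum k (fun n => h (p * (q * n))%N)))))).
    apply: eq_prime_sum => p _ _; rewrite (IH (fun n => h (p * n)%N)) -!prime_sumZ.
    by apply: eq_prime_sum => q _ _; ring.
  rewrite /prime_sum exchange_big /= mulr_sumr; apply: eq_bigr => q _.
  rewrite -!mulr_sumr; congr (_ * (_ * _)); apply: eq_bigr => p _.
  by congr (_ * _); apply: eq_tuple_sum => n _; rewrite mulnCA.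
by set Z := prime_sum _ _; rewrite -(natr1 k.+1) mulrDl mul1r addrC.
Qed.

(** These are T_k, V_k and S_{k,s}. The cutoff N is kept apart from x, so that one N at least floor
    x serves x and all the quotients x / p. *)
Definition tuple_inv k x : R := tuple_sum k (fun n => (n%:R <= x)%R%:R).
Definition tuple_lnq k x : R := tuple_sum k (fun n => if n%:R <= x then ln x - ln n%:R else 0).
Definition tuple_lnX k s x : R := tuple_sum k (fun n => if n%:R <= x then ln n%:R ^+ s else 0).

Lemma tuple_lnqE k x : tuple_lnq k x = ln x * tuple_inv k x - tuple_lnX k 1 x.
Proof.
rewrite /tuple_inv -tuple_sumZ -tuple_sumB; apply: eq_tuple_sum => n _; case: ifP => _.
  by rewrite mulr1.
by rewrite mulr0 subrr.
Qed.

Lemma tuple_lnq_lt1 k x : x < 1 -> tuple_lnq k x = 0.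
Proof.
move=> x1; rewrite -(tuple_sum0 k); apply: eq_tuple_sum => n n0; rewrite leNgt.
by rewrite (lt_le_trans x1) // ler1n.
Qed.

Lemma tuple_inv_lt1 k x : x < 1 -> tuple_inv k x = 0.
Proof.
move=> x1; rewrite -(tuple_sum0 k); apply: eq_tuple_sum => n n0; rewrite leNgt.
by rewrite (lt_le_trans x1) // ler1n.
Qed.

Lemma natM_le (p n : nat) x : (0 < p)%N -> ((p * n)%:R <= x) = (n%:R <= x / p%:R).
Proof. by move=> p0; rewrite natrM ler_pdivlMr ?ltr0n // mulrC. Qed.

Lemma prime_sum_cut x (f : R -> R) : 0 < x -> (Num.truncn x <= N)%N ->
  (forall z, z < 1 -> f z = 0) ->
  prime_sum N (fun p => p%:R^-1 * f (x / p%:R)) = prime_sum (Num.truncn x) (fun p => p%:R^-1 * f (x / p%:R)).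
Proof.
move=> x0 xN f0; apply: prime_sum_widen => // p pp /andP[px _].
rewrite f0 ?mulr0 // ltr_pdivrMr ?ltr0n ?prime_gt0 // mul1r.
by rewrite -truncn_lt_nat // ltW.
Qed.

(** The weight depends only on the quotient of x by the product, so detaching a prime p only changes
    x into x / p. *)
Lemma tuple_lnqS k x : 0 < x -> (Num.truncn x <= N)%N ->
  tuple_lnq k.+1 x = prime_sum (Num.truncn x) (fun p => p%:R^-1 * tuple_lnq k (x / p%:R)).
Proof.
move=> x0 xN; rewrite -(prime_sum_cut x0 xN (@tuple_lnq_lt1 k)); apply: eq_prime_sum => p pp _.
congr (_ * _); apply: eq_tuple_sum => n n0; rewrite natM_le ?prime_gt0 //; case: ifP => // _.
have p0 : 0 < p%:R :> R by rewrite ltr0n prime_gt0.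
have -> : ln (x / p%:R) = ln x - ln p%:R by rewrite ln_div ?posrE.
by rewrite (ln_natM R (prime_gt0 pp) n0); ring.
Qed.

Lemma tuple_invS k x : 0 < x -> (Num.truncn x <= N)%N ->
  tuple_inv k.+1 x = prime_sum (Num.truncn x) (fun p => p%:R^-1 * tuple_inv k (x / p%:R)).
Proof.
move=> x0 xN; rewrite -(prime_sum_cut x0 xN (@tuple_inv_lt1 k)); apply: eq_prime_sum => p pp _.
by congr (_ * _); apply: eq_tuple_sum => n n0; rewrite natM_le ?prime_gt0.
Qed.

Lemma prime_inv_ge0 x : 0 <= prime_inv x.
Proof. by apply: prime_sum_ge0 => p _ _; rewrite invr_ge0. Qed.

Lemma prime_inv_homo x y : x <= y -> prime_inv x <= prime_inv y.
Proof.
move=> xy; have := @le_truncn R _ _ xy => h; rewrite /prime_inv /prime_sum [leRHS](big_cat_nat (n := (Num.truncn x).+1)) //=.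
by rewrite lerDl sumr_ge0 // => p _; rewrite invr_ge0.
Qed.

(** The condition on the product is relaxed to p <= x for each prime, which decouples the primes. *)
Lemma tuple_inv_le k x y : 0 < y -> y <= x -> (Num.truncn x <= N)%N -> tuple_inv k y <= prime_inv x ^+ k.
Proof.
move=> y0 yx xN; have yN : (Num.truncn y <= N)%N by apply: leq_trans xN; exact: le_truncn.
elim: k y y0 yx yN => [|k IH] y y0 yx yN.
  by rewrite expr0 /tuple_inv /= lern1 leq_b1.
rewrite tuple_invS // exprS.
apply: le_trans (_ : prime_sum (Num.truncn y) (fun p => prime_inv x ^+ k * p%:R^-1) <= _).
  apply: ler_prime_sum => p pp _; rewrite mulrC; apply: ler_wpM2r; first by rewrite invr_ge0.
  have p0 : 0 < p%:R :> R by rewrite ltr0n prime_gt0.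
  have yp : y / p%:R <= y by rewrite ger_pMr // invf_le1 // ler1n prime_gt0.
  apply: IH; [exact: divr_gt0|exact: le_trans yx|].
  by apply: leq_trans yN; exact: le_truncn.
rewrite prime_sumZ mulrC; apply: ler_wpM2r; first by rewrite exprn_ge0 // prime_inv_ge0.
exact: prime_inv_homo.
Qed.

(** The difference of powers is b - a times s + 1 terms, each between a^s and b^s. *)
Lemma exprn_sub_bounds s (a b : R) : 0 <= a -> a <= b ->
  a ^+ s * (b - a) <= (b ^+ s.+1 - a ^+ s.+1) / s.+1%:R <= b ^+ s * (b - a).
Proof.
move=> a0 ab; have b0 : 0 <= b by lra.
have s0 : 0 < s.+1%:R :> R by rewrite ltr0n.
rewrite ler_pdivlMr // ler_pdivrMr // subrXX.
have ba : 0 <= b - a by lra.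
rewrite -!(mulrA _ (b - a)) !(mulrCA _ (b - a)); apply/andP; split; apply: ler_wpM2l => //.
  rewrite mulr_natr -{1}[s.+1]card_ord -sumr_const; apply: ler_sum => i _.
  have -> : a ^+ s = a ^+ (s.+1.-1 - i) * a ^+ i by rewrite -exprD subnK // -ltnS.
  by apply: ler_wpM2r; rewrite ?exprn_ge0 // lerXn2r ?nnegrE.
rewrite mulr_natr -[X in _ <= _ *+ X]card_ord -sumr_const; apply: ler_sum => i _.
have -> : b ^+ s = b ^+ (s.+1.-1 - i) * b ^+ i by rewrite -exprD subnK // -ltnS.
by apply: ler_wpM2l; rewrite ?exprn_ge0 // lerXn2r ?nnegrE.
Qed.

(** Abel summation over p <= x / n with g(v) = (log n + v)^s, which is nondecreasing and so is its
    own variation; 13 = 4 + 4 + 5. *)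
Lemma prime_sum_ln_pow s n x : (0 < n)%N -> n%:R <= x -> (Num.truncn x <= N)%N ->
  `|prime_sum N (fun p => ln p%:R / p%:R * (if (p * n)%:R <= x then ln (p * n)%:R ^+ s else 0))
    - (ln x ^+ s.+1 - ln n%:R ^+ s.+1) / s.+1%:R| <= 13 * ln x ^+ s.
Proof.
move=> n0 nx xN; have n0R : 0 < n%:R :> R by rewrite ltr0n.
have x0 : 0 < x by lra.
set a := ln n%:R; have a0 : 0 <= a by exact: ln_nat_ge0.
have ax : a <= ln x by rewrite ler_ln ?posrE.
have xn1 : 1 <= x / n%:R by rewrite ler_pdivlMr // mul1r.
have lxn : ln (x / n%:R) = ln x - a by rewrite ln_div ?posrE.
have := @prime_sum_ln_approx R 1 (x / n%:R) (fun v => (a + v) ^+ s)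
  (fun v => (a + v) ^+ s.+1 / s.+1%:R) (fun v => (a + v) ^+ s) isT xn1.
rewrite lxn ln1 addr0 addrCA subrr addr0.
have -> : prime_sum 1 (fun p => ln p%:R / p%:R * (a + ln p%:R) ^+ s) = 0.
  by rewrite prime_sumS prime_sum0 addr0.
rewrite subr0 -mulrBl.
have -> : prime_sum N (fun p => ln p%:R / p%:R * (if (p * n)%:R <= x then ln (p * n)%:R ^+ s else 0)) =
   prime_sum (Num.truncn (x / n%:R)) (fun p => ln p%:R / p%:R * (a + ln p%:R) ^+ s).
  have xn0 : 0 <= x / n%:R by lra.
  rewrite (@prime_sum_widen (Num.truncn (x / n%:R))).
  - apply: eq_prime_sum => p pp; rewrite truncn_ge_nat // -natM_le // mulnC => ->.
    by rewrite (ln_natM R (prime_gt0 pp) n0) addrC.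
  - apply: leq_trans xN; apply: le_truncn; rewrite ger_pMr // invf_le1 // ler1n //.
  - move=> p pp /andP[px _]; rewrite mulnC natM_le // leNgt -truncn_lt_nat // px mulr0 //.
move=> H; apply: le_trans (H _ _) _.
- move=> c d c0 cd dx; rewrite ger0_norm // subr_ge0; apply: lerXn2r; rewrite ?nnegrE; lra.
- move=> c d c0 cd dx.
  have /andP[h1 h2] := @exprn_sub_bounds s (a + c) (a + d) (addr_ge0 a0 c0) (lerD (lexx a) cd).
  move: h1 h2; have -> : a + d - (a + c) = d - c by ring.
  rewrite -mulrBl; set Q := (_ - _) / _; move: Q => Q.
  by move: ((a + d) ^+ s) ((a + c) ^+ s) => A B h1 h2; rewrite ler_norml; lra.
have h1 : 0 <= a ^+ s by rewrite exprn_ge0.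
have h2 : a ^+ s <= ln x ^+ s by apply: lerXn2r; rewrite ?nnegrE; lra.
rewrite !ger0_norm //; lra.
Qed.

(** One factor log n of log^(s+1) n is spread over the k + 1 primes by [tuple_sum_ln]. With the sum
    over the distinguished prime moved inside, [prime_sum_ln_pow] evaluates it for each product n of
    the other k. *)
Lemma tuple_lnX_rec k s x : 1 <= x -> (Num.truncn x <= N)%N ->
  `|tuple_lnX k.+1 s.+1 x - k.+1%:R / s.+1%:R * (ln x ^+ s.+1 * tuple_inv k x - tuple_lnX k s.+1 x)|
    <= 13 * k.+1%:R * ln x ^+ s * tuple_inv k x.
Proof.
move=> x1 xN; have u0 : 0 <= ln x by rewrite ln_ge0.
pose h n := if n%:R <= x then ln n%:R ^+ s else 0 : R.
have -> : tuple_lnX k.+1 s.+1 x = k.+1%:R * tuple_sum k (fun n => prime_sum N (fun p => ln p%:R / p%:R * h (p * n)%N)).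
  rewrite (tuple_sum_prime_sum k _ (fun p n => h (p * n)%N)) -tuple_sum_ln; apply: eq_tuple_sum => n n0.
  by rewrite /h; case: ifP => _; rewrite ?mul0r // exprSr.
have -> : k.+1%:R / s.+1%:R * (ln x ^+ s.+1 * tuple_inv k x - tuple_lnX k s.+1 x) =
   k.+1%:R * tuple_sum k (fun n => if n%:R <= x then (ln x ^+ s.+1 - ln n%:R ^+ s.+1) / s.+1%:R else 0).
  rewrite -mulrA; congr (_ * _); rewrite -tuple_sumZ -tuple_sumB -tuple_sumZ; apply: eq_tuple_sum => n n0.
  by case: ifP => _; rewrite ?mulr1 ?mulr0 ?subrr ?mulr0 // mulrC.
rewrite -mulrBr normrM ger0_norm // (mulrC 13) -!mulrA; apply: ler_wpM2l => //.
rewrite -tuple_sumB; apply: le_trans (ler_norm_tuple_sum _ _) _.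
rewrite mulrA -tuple_sumZ; apply: ler_tuple_sum => n n0.
case: ifP => nx; first by rewrite mulr1; exact: prime_sum_ln_pow.
rewrite mulr0 subr0 /prime_sum big1 ?normr0 // => p pp; rewrite /h.
have -> : ((p * n)%:R <= x) = false; last by rewrite mulr0.
apply/negbTE; rewrite -ltNge; move/negbT: nx; rewrite -ltNge => /lt_le_trans; apply.
by rewrite ler_nat leq_pmull // prime_gt0.
Qed.
End TupleSums.

(** * Asymptotics of the tuple sums in powers of log x and log log x *)

Section Asymptotics.
Variable R : realType.
Variable K : nat.
Implicit Types (q : {poly R}) (x y : R) (k s N : nat).

Lemma size_derivn_le q i : (size q^`(i) <= size q)%N.
Proof.
apply/leq_sizeP => j sj; rewrite coef_derivn nth_default ?mul0rn //.
by rewrite (leq_trans sj) // leq_addl.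
Qed.

Lemma size_conv_op q : (size (conv_op K q) <= (size q).+1)%N.
Proof.
apply: leq_trans (size_polyD _ _) _; rewrite geq_max; apply/andP; split.
  by apply: leq_trans (size_polyMleq _ _) _; rewrite size_XaddC.
apply: (big_ind (fun p : {poly R} => (size p <= (size q).+1)%N)).
- by rewrite size_poly0.
- by move=> p p' sp sp'; apply: leq_trans (size_polyD _ _) _; rewrite geq_max sp.
- move=> i _; apply: leq_trans (size_scale_leq _ _) _.
  by apply: leq_trans (size_derivn_le _ _) _.
Qed.

Lemma conv_opD q q' : conv_op K (q + q') = conv_op K q + conv_op K q'.
Proof.
rewrite /conv_op mulrDr -addrA [RHS]addrACA -!addrA; congr (_ + (_ + _)).
by rewrite -big_split /=; apply: eq_bigr => i _; rewrite derivnD scalerDr.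
Qed.

(** Only multiplication by 'X fails to commute with differentiation; this makes [Rpoly] an Appell
    sequence. *)
Lemma deriv_conv_op q : (conv_op K q)^`() = conv_op K q^`() + q.
Proof.
rewrite /conv_op derivD derivM derivD derivX derivC addr0 mul1r [q + _]addrC.
rewrite addrAC; congr (_ + _ + _); rewrite raddf_sum /=; apply: eq_bigr => i _.
by rewrite derivZ -derivnS derivSn.
Qed.

(** R_k, with R_0 = 1 because V_0(x) = log x, and then R_k + R_k'. The estimates for them take k <=
    K, so that [conv_op] meets only degrees below K. *)
Definition Rpoly k : {poly R} := iter k (conv_op K) 1.
Definition Ppoly k : {poly R} := Rpoly k + (Rpoly k)^`().

Lemma size_Rpoly k : (size (Rpoly k) <= k.+1)%N.
Proof.
elim: k => [|k IH]; first by rewrite /Rpoly /= size_poly1.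
by apply: leq_trans (size_conv_op _) _.
Qed.

Lemma conv_opMn q n : conv_op K (q *+ n) = conv_op K q *+ n.
Proof.
elim: n => [|n IH]; last by rewrite !mulrS conv_opD IH.
rewrite !mulr0n /conv_op mulr0 add0r big1 // => i _.
by rewrite derivn_poly0 ?size_poly0 // scaler0.
Qed.

Lemma deriv_Rpoly k : (Rpoly k)^`() = Rpoly k.-1 *+ k.
Proof.
elim: k => [|k IH]; first by rewrite /Rpoly /= -polyC1 derivC mulr0n.
rewrite [Rpoly k.+1]/= deriv_conv_op IH conv_opMn mulrS addrC /=; congr (_ + _).
by case: k {IH} => [|k]; rewrite ?mulr0n.
Qed.

Lemma lnln_ge1 x : 1 <= ln (ln x) -> 1 < ln x /\ 2 <= x.
Proof.
move=> v1.
have u1 : 1 < ln x by rewrite ltNge; apply/negP => /ln_le0; lra.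
split => //; have x0 : 0 < x by rewrite ltNge; apply/negP => h; move: u1; rewrite ln0 //; lra.
have := ln_le_subr1 x0; lra.
Qed.

Lemma prime_inv_bound : exists2 c : R, 0 <= c &
  forall x, 1 <= ln (ln x) -> prime_inv x <= c * ln (ln x).
Proof.
exists (`|mertensB R| + 53); first by rewrite addr_ge0.
move=> x v1; have [u1 x2] := lnln_ge1 v1.
have := mertens_second x2; rewrite ler_norml => /andP[_ h].
have h1 : 52 / ln x <= 52 by rewrite ler_pdivrMr ?ler_peMr //; lra.
have h2 : `|mertensB R| <= `|mertensB R| * ln (ln x) by rewrite ler_peMr.
have h3 := ler_norm (mertensB R).
lra.
Qed.

(** The bound is uniform in y <= x and stated in log log x, because the induction uses it at y / p,
    where log log (y / p) may be small or meaningless. *)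
Lemma tuple_lnq_asymp k : (k <= K)%N -> exists2 C : R, 0 <= C &
  forall N x y, 1 <= ln (ln x) -> 1 <= y -> y <= x -> (Num.truncn x <= N)%N ->
    `|tuple_lnq N k y - Psi (Rpoly k) (ln y)| <= C * ln (ln x) ^+ k.
Proof.
elim: k => [|k IH] kK.
  exists 0 => // N x y v1 y1 yx xN.
  by rewrite /tuple_lnq /= y1 ln1 subr0 /Psi /Rpoly /= hornerE mulr1 subrr normr0 mul0r.
have [C C0 HC] := IH (ltnW kK).
have [C1 C10 HC1] := prime_sum_Psi (size_Rpoly k) kK.
have [C2 C20 HC2] := Psi_small (Rpoly k).
have [C3 C30 HC3] := Psi_small (Rpoly k.+1).
have [c c0 Hc] := prime_inv_bound.
have e0 := prime_inv_ge0 (expR (expR 1) : R).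
exists (C * c + (C1 + (C2 * prime_inv (expR (expR 1)) + C3))).
  by rewrite !addr_ge0 ?mulr_ge0.
move=> N x y v1 y1 yx xN; have [u1 x2] := lnln_ge1 v1.
have y0 : 0 < y by lra.
set L := ln (ln x) in v1 *.
have yN : (Num.truncn y <= N)%N by apply: leq_trans xN; exact: le_truncn.
rewrite tuple_lnqS //.
(* [P] has the main term in place of V_k: the replacement costs C L^k times the sum of 1 / p, and
   [prime_sum_Psi] evaluates [P]. *)
set P := prime_sum (Num.truncn y) (fun p => p%:R^-1 * Psi (Rpoly k) (ln y - ln p%:R)).
have -> : prime_sum (Num.truncn y) (fun p => p%:R^-1 * tuple_lnq N k (y / p%:R)) - Psi (Rpoly k.+1) (ln y) =
  (prime_sum (Num.truncn y) (fun p => p%:R^-1 * tuple_lnq N k (y / p%:R)) - P) + (P - Psi (Rpoly k.+1) (ln y)).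
  by ring.
apply: le_trans (ler_normD _ _) _; rewrite mulrDl; apply: lerD.
  rewrite /P -prime_sumB; apply: le_trans (ler_norm_prime_sum _ _) _.
  apply: le_trans (_ : prime_sum (Num.truncn y) (fun p => (C * L ^+ k) * p%:R^-1) <= _).
    apply: ler_prime_sum => p pp; rewrite truncn_ge_nat ?(ltW y0) // => py.
    have p0 : 0 < p%:R :> R by rewrite ltr0n prime_gt0.
    rewrite -mulrBr normrM ger0_norm ?invr_ge0 // [leRHS]mulrC.
    apply: ler_wpM2l; first by rewrite invr_ge0.
    have -> : ln y - ln p%:R = ln (y / p%:R) by rewrite ln_div ?posrE.
    apply: HC => //; first by rewrite ler_pdivlMr // mul1r.
    by apply: le_trans yx; rewrite ger_pMr // invf_le1 // ler1n prime_gt0.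
  rewrite prime_sumZ exprS mulrACA (mulrC c) -mulrA (mulrC (L ^+ k)) -!mulrA; apply: ler_wpM2l => //.
  rewrite mulrA mulrC; apply: ler_wpM2r; first by rewrite exprn_ge0 //; lra.
  rewrite mulrC; apply: le_trans (Hc _ v1); exact: prime_inv_homo.
have L0 : 0 <= L by lra.
have L1 : 1 <= L ^+ k.+1 by rewrite exprn_ege1.
(* For log log y < 1, y is at most e^e, and [P] and the main term are bounded by constants. *)
have [v1y|v1y] := leP 1 (ln (ln y)).
  apply: le_trans (HC1 y v1y) _; apply: ler_pM => //; first by rewrite exprn_ge0 //; lra.
    by rewrite lerDl addr_ge0 // mulr_ge0.
  have [uy1 _] := lnln_ge1 v1y.
  apply: lerXn2r; rewrite ?nnegrE //; first by lra.
  by rewrite ler_ln ?posrE ?ler_ln ?posrE //; lra.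
have uy0 : 0 <= ln y by rewrite ln_ge0.
have uye : ln y <= expR 1.
  rewrite leNgt; apply/negP => h; move: v1y; rewrite ltNge -{1}(expRK 1) ler_ln ?posrE ?expR_gt0 //.
    by rewrite ltW.
  by apply: lt_trans h; rewrite expR_gt0.
have yee : y <= expR (expR 1).
  by rewrite -ler_ln ?posrE ?expR_gt0 // expRK.
apply: le_trans (_ : C2 * prime_inv (expR (expR 1)) + C3 <= _); last first.
  apply: le_trans (_ : C1 + (C2 * prime_inv (expR (expR 1)) + C3) <= _); first by rewrite lerDr.
  by rewrite ler_peMr // !addr_ge0 // mulr_ge0.
apply: le_trans (ler_normB _ _) _; apply: lerD; last by apply: HC3; rewrite uy0.
rewrite /P; apply: le_trans (ler_norm_prime_sum _ _) _.
apply: le_trans (_ : prime_sum (Num.truncn y) (fun p => C2 * p%:R^-1) <= _); last first.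
  by rewrite prime_sumZ; apply: ler_wpM2l => //; exact: prime_inv_homo.
apply: ler_prime_sum => p pp; rewrite truncn_ge_nat ?(ltW y0) // => py.
rewrite normrM ger0_norm ?invr_ge0 // mulrC; apply: ler_wpM2r; first by rewrite invr_ge0.
have p0 : 0 < p%:R :> R by rewrite ltr0n prime_gt0.
apply: HC2; rewrite subr_ge0 ler_ln ?posrE // py /=.
by have := ln_nat_ge0 R p; lra.
Qed.

Lemma tuple_inv_bound k : exists2 C : R, 0 <= C &
  forall N x, 1 <= ln (ln x) -> (Num.truncn x <= N)%N -> tuple_inv N k x <= C * ln (ln x) ^+ k.
Proof.
have [c c0 Hc] := prime_inv_bound; exists (c ^+ k); first exact: exprn_ge0.
move=> N x v1 xN; have [u1 x2] := lnln_ge1 v1.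
apply: le_trans (_ : prime_inv x ^+ k <= _); first by apply: tuple_inv_le => //; lra.
rewrite -exprMn; apply: lerXn2r; rewrite ?nnegrE ?prime_inv_ge0 ?Hc //.
by rewrite mulr_ge0 //; lra.
Qed.

(** By definition log x T_{k+1} = V_{k+1} + S_{k+1,1}, and [tuple_lnX_rec] makes S_{k+1,1} equal to
    (k + 1) V_k up to the error; (k + 1) R_k is the derivative of R_{k+1}. *)
Lemma tuple_inv_asymp k : (k <= K)%N -> exists2 C : R, 0 <= C &
  forall N x, 1 <= ln (ln x) -> (Num.truncn x <= N)%N ->
    `|ln x * tuple_inv N k x - ln x * (Ppoly k).[ln (ln x)]| <= C * ln (ln x) ^+ k.
Proof.
case: k => [|k] kK.
  exists 0 => // N x v1 xN; have [u1 x2] := lnln_ge1 v1.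
  rewrite /tuple_inv /= (_ : (1 <= x) = true); last by apply/idP; lra.
  by rewrite /Ppoly /Rpoly /= -polyC1 derivC addr0 hornerC subrr normr0 mul0r.
have [C1 C10 HC1] := tuple_lnq_asymp kK.
have [C0 C00 HC0] := tuple_lnq_asymp (ltnW kK).
have [c c0 Hc] := tuple_inv_bound k.
exists (C1 + k.+1%:R * (C0 + 13 * c)); first by rewrite addr_ge0 // mulr_ge0 // addr_ge0 // mulr_ge0.
move=> N x v1 xN; have [u1 x2] := lnln_ge1 v1.
have x1 : 1 <= x by lra.
have h1 := HC1 N x x v1 x1 (lexx x) xN.
have h0 := HC0 N x x v1 x1 (lexx x) xN.
have ht := Hc N x v1 xN.
have := tuple_lnX_rec k 0 x1 xN; rewrite divr1 expr1 -tuple_lnqE expr0 mulr1 => hs.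
set u := ln x in u1 v1 h1 h0 ht hs *; set L := ln u in v1 h1 h0 ht *.
have L1 : L ^+ k <= L ^+ k.+1 by rewrite ler_weXn2l.
have Lk0 : 0 <= L ^+ k by rewrite exprn_ge0 //; lra.
have -> : u * tuple_inv N k.+1 x = tuple_lnq N k.+1 x + tuple_lnX N k.+1 1 x by rewrite tuple_lnqE -/u; ring.
have -> : u * (Ppoly k.+1).[L] = Psi (Rpoly k.+1) u + k.+1%:R * Psi (Rpoly k) u.
  by rewrite /Ppoly deriv_Rpoly hornerD hornerMn -mulr_natl /Psi -/L; ring.
have -> : tuple_lnq N k.+1 x + tuple_lnX N k.+1 1 x - (Psi (Rpoly k.+1) u + k.+1%:R * Psi (Rpoly k) u) =
  (tuple_lnq N k.+1 x - Psi (Rpoly k.+1) u) + (tuple_lnX N k.+1 1 x - k.+1%:R * tuple_lnq N k x)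
  + k.+1%:R * (tuple_lnq N k x - Psi (Rpoly k) u) by ring.
have -> : (C1 + k.+1%:R * (C0 + 13 * c)) * L ^+ k.+1 =
  C1 * L ^+ k.+1 + k.+1%:R * (13 * (c * L ^+ k.+1)) + k.+1%:R * (C0 * L ^+ k.+1) by ring.
apply: le_trans (ler_normD _ _) _; apply: lerD.
  apply: le_trans (ler_normD _ _) _; apply: lerD => //.
  apply: le_trans hs _; rewrite (mulrC 13) -!mulrA; apply: ler_wpM2l => //.
  apply: ler_wpM2l => //; apply: le_trans ht _; exact: ler_wpM2l.
rewrite normrM ger0_norm //; apply: ler_wpM2l => //.
apply: le_trans h0 _; exact: ler_wpM2l.
Qed.

(** The claimed expansion with [Ppoly] in place of [Pj]. *)
Definition main_term k s x : R :=
  \sum_(0 <= l < k) (-1) ^+ l * ((arr k l.+1)%:R / s%:R ^+ l.+1)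
     * (Ppoly (k - 1 - l)).[ln (ln x)] * ln x ^+ s.

(** The recursion of [tuple_lnX_rec] without error: the term l = 0 splits off, and A_{k+1}^{l+2} =
    (k + 1) A_k^{l+1} handles the rest. *)
Lemma main_termS k s x : (0 < s)%N ->
  main_term k.+1 s x = k.+1%:R / s%:R * ((Ppoly k).[ln (ln x)] * ln x ^+ s - main_term k s x).
Proof.
move=> s0; have sR : s%:R != 0 :> R by rewrite pnatr_eq0 -lt0n.
rewrite /main_term big_ltn // big_add1 /= mulrBr; congr (_ + _).
  by rewrite /arr bin1 factS fact0 !muln1 subn1 subn0 !expr1 expr0 mul1r mulrA.
rewrite mulr_sumr -sumrN; apply: eq_bigr => l _.
have -> : (k.+1 - 1 - l.+1)%N = (k - 1 - l)%N by lia.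
have -> : (arr k.+1 l.+2)%:R = k.+1%:R * (arr k l.+1)%:R :> R.
  rewrite -natrM /arr; congr (_%:R).
  by rewrite !bin_ffact ffactSS.
by rewrite !exprS; field; rewrite ?expf_neq0.
Qed.

Lemma tuple_lnX_asymp k s : (k <= K.+1)%N -> exists2 C : R, 0 <= C &
  forall N x, 1 <= ln (ln x) -> (Num.truncn x <= N)%N ->
    `|tuple_lnX N k s.+1 x - main_term k s.+1 x| <= C * (ln x ^+ s * ln (ln x) ^+ k).
Proof.
elim: k => [|k IH] kK.
  exists 0 => // N x v1 xN; rewrite /main_term big_geq // /tuple_lnX /= ln1 expr0n /=.
  by rewrite if_same subr0 normr0 mul0r.
have [C0 C00 HC0] := IH (ltnW kK).
have [C1 C10 HC1] := tuple_inv_asymp kK.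
have [c c0 Hc] := tuple_inv_bound k.
exists (k.+1%:R * (C1 + C0 + 13 * c)); first by rewrite mulr_ge0 // !addr_ge0 // mulr_ge0.
move=> N x v1 xN; have [u1 x2] := lnln_ge1 v1.
have x1 : 1 <= x by lra.
have h0 := HC0 N x v1 xN; have h1 := HC1 N x v1 xN; have ht := Hc N x v1 xN.
have hs := tuple_lnX_rec k s x1 xN.
rewrite main_termS //.
set u := ln x in u1 v1 h1 h0 ht hs *; set L := ln u in v1 h1 h0 ht *.
have L1 : L ^+ k <= L ^+ k.+1 by rewrite ler_weXn2l.
have Lk0 : 0 <= L ^+ k by rewrite exprn_ge0 //; lra.
have u0 : 0 <= u ^+ s by rewrite exprn_ge0 //; lra.
set A := tuple_lnX N k.+1 s.+1 x in hs *; set B := tuple_lnX N k s.+1 x in hs h0 *.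
set D := main_term k s.+1 x in h0 *; set T := tuple_inv N k x in hs h1 ht *; set p := (Ppoly k).[L] in h1 *.
have s1 : 1 <= s.+1%:R :> R by rewrite ler1n.
have f0 : 0 <= k.+1%:R / s.+1%:R :> R by rewrite divr_ge0.
have fk : k.+1%:R / s.+1%:R <= k.+1%:R :> R by rewrite ler_pdivrMr ?ler_peMr //; lra.
have -> : A - k.+1%:R / s.+1%:R * (p * u ^+ s.+1 - D) =
   (A - k.+1%:R / s.+1%:R * (u ^+ s.+1 * T - B))
   + k.+1%:R / s.+1%:R * (u ^+ s * (u * T - u * p) - (B - D)).
  by rewrite exprS; ring.
apply: le_trans (_ : k.+1%:R * (C1 + C0 + 13 * c) * (u ^+ s * L ^+ k) <= _); last first.
  apply: ler_wpM2l; last exact: ler_wpM2l.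
  by rewrite mulr_ge0 // !addr_ge0 // mulr_ge0.
apply: le_trans (ler_normD _ _) _.
have -> : k.+1%:R * (C1 + C0 + 13 * c) * (u ^+ s * L ^+ k) =
  k.+1%:R * (13 * (u ^+ s * (c * L ^+ k))) + k.+1%:R * (u ^+ s * (C1 * L ^+ k) + C0 * (u ^+ s * L ^+ k)).
  by ring.
apply: lerD.
  apply: le_trans hs _; rewrite (mulrC 13) -!mulrA; do 3 apply: ler_wpM2l => //.
rewrite normrM ger0_norm //; apply: ler_pM => //.
apply: le_trans (ler_normB _ _) _; apply: lerD => //.
by rewrite normrM ger0_norm //; apply: ler_wpM2l.
Qed.
End Asymptotics.

(** * Identification of R_k + R_k' with the polynomials P_k *)

Section Coefficients.
Variable R : realType.
Variable K : nat.
Implicit Types (q : {poly R}) (k n : nat).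
Notation Ppoly := (Ppoly R K).
Notation Rpoly := (Rpoly R K).

(** The Neumann series inverting 1 + D, D being differentiation, ends because D is nilpotent in
    bounded degree. It recovers R_k from R_k + R_k'. *)
Lemma alternating_derivn q : (size q <= K)%N ->
  \sum_(0 <= i < K) (-1) ^+ i *: (q + q^`())^`(i) = q.
Proof.
move=> sq.
have H n : \sum_(0 <= i < n) (-1) ^+ i *: (q + q^`())^`(i) = q - (-1) ^+ n *: q^`(n).
  elim: n => [|n IH]; first by rewrite big_geq // expr0 scale1r subrr.
  rewrite big_nat_recr //= IH derivnD -derivSn scalerDr addrA subrK exprS mulN1r scaleNr opprK.
  by [].
by rewrite H derivn_poly0 // scaler0 subr0.
Qed.

(** By [deriv_conv_op], [Ppoly k.+1] is [conv_op K (Ppoly k)] plus R_k. Writing R_k as the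
    alternating sum of derivatives of [Ppoly k] adds 1 to B - 1 and to each zeta(i + 1) - 1. *)
Lemma PpolyS k : (k < K)%N ->
  Ppoly k.+1 = ('X + (mertensB R)%:P) * Ppoly k
    + \sum_(1 <= i < K) ((-1) ^+ i * zeta R i.+1) *: (Ppoly k)^`(i).
Proof.
move=> kK; have E := alternating_derivn (leq_trans (size_Rpoly R K k) kK).
rewrite -/(Ppoly k) big_ltn in E; last exact: leq_ltn_trans kK.
rewrite expr0 scale1r derivn0 in E.
rewrite {1}/Ppoly [Rpoly k.+1]/= deriv_conv_op addrA -conv_opD -/(Ppoly k) -[X in _ + X]E /conv_op.
have -> : \sum_(1 <= i < K) ((-1) ^+ i * (zeta R i.+1 - 1)) *: (Ppoly k)^`(i) =
   \sum_(1 <= i < K) ((-1) ^+ i * zeta R i.+1) *: (Ppoly k)^`(i) -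
   \sum_(1 <= i < K) (-1) ^+ i *: (Ppoly k)^`(i).
  by rewrite -sumrB; apply: eq_bigr => i _; rewrite -scalerBl mulrBr mulr1.
set Z := \sum_(1 <= i < K) _; set Y := \sum_(1 <= i < K) _.
rewrite polyCB polyC1; ring.
Qed.

Lemma deriv_Ppoly k : (Ppoly k)^`() = Ppoly k.-1 *+ k.
Proof.
rewrite /Ppoly derivD deriv_Rpoly derivMn deriv_Rpoly -mulrnDl.
by case: k => [|k]; rewrite ?mulr0n.
Qed.

Lemma derivn_Ppoly k i : (Ppoly k)^`(i) = Ppoly (k - i) *+ (k ^_ i).
Proof.
elim: i => [|i IH]; first by rewrite derivn0 subn0 ffactn0 mulr1n.
by rewrite derivnS IH derivMn deriv_Ppoly ffactnSr -mulrnA subnS mulnC.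
Qed.

(** Setting a_0 = 1 and a_1 = 0 makes P_j the plain binomial sum of C_j^m a_m (y + B)^(j-m). *)
Definition ahat n : R := match n with 0 => 1 | 1 => 0 | _ => acoef R n end.

(** The defining recursion as one sum: i = n - 1 drops out as a_1 = 0, and i = n gives the isolated
    zeta term as a_0 = 1. The initial values are checked one by one. *)
Lemma ahatS n : ahat n.+1 =
  \sum_(1 <= i < n.+1) (-1) ^+ i * zeta R i.+1 * (ahat (n - i) *+ (n ^_ i)).
Proof.
have F i m : ahat m *+ (n ^_ i) = 'C(n, i)%:R * i`!%:R * ahat m.
  by rewrite -(mulr_natl (ahat m)) -natrM bin_ffact.
under eq_bigr do rewrite F.
case: n {F} => [|[|[|[|n]]]]; first by rewrite big_geq.
- by rewrite big_nat1 /= acoef2 expr1 !mulr1 mulN1r.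
- rewrite big_nat_recl // big_nat1 /= acoef3 !mulr0 add0r.
  by rewrite sqrrN expr1n mul1r mulr1 binn mul1r mulrC.
- rewrite big_nat_recl // big_nat_recl // big_nat1 /= acoef4 acoef2 binn.
  have -> : 'C(3, 1) = 3%N by [].
  have -> : 3`! = 6%N by [].
  have -> : 1`! = 1%N by [].
  by ring.
rewrite -[ahat n.+4.+1]/(acoef R n.+4.+1) acoefE //.
have -> : (n.+4.+1 - 2 = n.+3)%N by rewrite subn2.
have -> : (n.+4.+1 - 1 = n.+4)%N by rewrite subn1.
rewrite [RHS]big_nat_recr // [X in _ = X + _]big_nat_recr //.
have -> : (n.+4 - n.+3 = 1)%N by rewrite subSnn.
rewrite subnn /= mulr0 mulr0 addr0 binn mulr1 mul1r.
congr (_ + _); last by ring.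
rewrite big_nat [RHS]big_nat; apply: eq_bigr => i /andP[i1 i2].
have -> : ahat (n.+4 - i) = acoef R (n.+4 - i).
  rewrite /ahat; have : (1 < n.+4 - i)%N by rewrite ltn_subRL addn1.
  by case: (n.+4 - i)%N => [|[|m]].
by ring.
Qed.

(** At -B the factor X + B in [PpolyS] vanishes, and the Appell property turns derivatives into
    earlier values: what remains is [ahatS]. *)
Lemma Ppoly_at_mertensB k : (k <= K)%N -> (Ppoly k).[- mertensB R] = ahat k.
Proof.
elim/ltn_ind: k => [[|k] IH] kK.
  by rewrite /Ppoly /Rpoly /= -polyC1 derivC addr0 hornerC.
rewrite PpolyS // ahatS hornerD hornerM hornerD hornerX hornerC addNr mul0r add0r.
rewrite horner_sum (big_cat_nat (n := k.+1)) //= [X in _ + X]big_nat [X in _ + X]big1 ?addr0; last first.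
  by move=> i /andP[ki _]; rewrite derivn_Ppoly ffact_small // mulr0n scaler0 horner0.
rewrite big_nat [RHS]big_nat; apply: eq_bigr => i /andP[i1 ik].
by rewrite derivn_Ppoly hornerZ hornerMn IH // ?ltnS ?leq_subr // (leq_trans (leq_subr _ _)) // ltnW.
Qed.

(** Taylor expansion at -B; by the Appell property its i-th coefficient is C_k^i a_{k-i}. *)
Lemma Ppoly_Pj k (y : R) : (k <= K)%N -> (Ppoly k).[y] = Pj k y.
Proof.
move=> kK; set z := y + mertensB R.
have -> : Pj k y = \sum_(m < k.+1) 'C(k, m)%:R * ahat m * z ^+ (k - m).
  rewrite /Pj -/z; case: k kK => [|[|k]] kK.
  - by rewrite big_ord1 /= bin0 !mulr1.
  - by rewrite big_ord_recl big_ord1 /= bin0 mulr0 mul0r addr0 !mul1r expr1.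
  rewrite big_ord_recl big_ord_recl /= mulr0 mul0r add0r bin0 !mul1r subn0.
  congr (_ + _); rewrite big_add1 big_add1 /= big_mkord.
  by apply: eq_bigr => i _.
have spk : (size (Ppoly k) <= k.+1)%N.
  apply: leq_trans (size_polyD _ _) _; rewrite geq_max size_Rpoly /=.
  by apply: leq_trans (size_derivn_le _ 1) _; exact: size_Rpoly.
have -> : y = - mertensB R + z by rewrite /z addrC addrK.
rewrite (@nderiv_taylor_wide _ k.+1); [|exact: mulrC|exact: spk].
rewrite (reindex_inj rev_ord_inj) /=; apply: eq_bigr => i _.
rewrite subSS; congr (_ * _); have ik : (i <= k)%N by rewrite -ltnS.
have f0 : ((k - i)`!)%:R != 0 :> R by rewrite pnatr_eq0 -lt0n fact_gt0.
apply: (mulIf f0); rewrite mulr_natr -hornerMn -nderivn_def derivn_Ppoly hornerMn subKn //.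
rewrite Ppoly_at_mertensB; last exact: leq_trans kK.
by rewrite -bin_ffact bin_sub // -mulr_natl natrM mulrAC.
Qed.
End Coefficients.

(** * From recursive tuple sums to sums over finite functions *)

Section Reindexing.
Variable R : realType.

Lemma big_ffun_recl (T : finType) k (F : {ffun 'I_k.+1 -> T} -> R) :
  \sum_f F f = \sum_(t : T) \sum_(g : {ffun 'I_k -> T})
     F [ffun i => if unlift ord0 i is Some j then g j else t].
Proof.
rewrite pair_big /=.
pose cons (tg : T * {ffun 'I_k -> T}) : {ffun 'I_k.+1 -> T} :=
  [ffun i => if unlift ord0 i is Some j then tg.2 j else tg.1].
pose unc (f : {ffun 'I_k.+1 -> T}) : T * {ffun 'I_k -> T} :=
  (f ord0, [ffun j => f (lift ord0 j)]).
have c1 : cancel cons unc.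
  move=> [t g]; rewrite /unc /cons /=; congr (_, _); first by rewrite ffunE unlift_none.
  by apply/ffunP => j; rewrite !ffunE liftK.
have c2 : cancel unc cons.
  move=> f; apply/ffunP => i; rewrite !ffunE /=.
  by case: unliftP => [j|] ->; rewrite ?ffunE.
rewrite (reindex cons) /=; last by exists unc => ? _.
by apply: eq_bigr => -[t g] _.
Qed.

Lemma tuple_sum_ffun N k (h : nat -> R) :
  tuple_sum N k h = \sum_(p : {ffun 'I_k -> 'I_N.+1} | [forall i, prime (p i)])
     h (\prod_(i < k) p i)%N / (\prod_(i < k) p i)%N%:R.
Proof.
elim: k h => [|k IH] h.
  rewrite (big_pred1 [ffun i : 'I_0 => ord0]) /=; last first.
    move=> p; rewrite [RHS](_ : _ = true); first by apply/forallP => -[].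
    by apply/eqP/ffunP => -[].
  by rewrite big_ord0 divr1.
rewrite big_mkcond big_ffun_recl /= /prime_sum big_mkord big_mkcond /=.
apply: eq_bigr => t _.
pose c (g : {ffun 'I_k -> 'I_N.+1}) : {ffun 'I_k.+1 -> 'I_N.+1} :=
  [ffun i => if unlift ord0 i is Some j then g j else t].
have Eall g : [forall i, prime (c g i)] = prime t && [forall i, prime (g i)].
  apply/forallP/andP => [H|[pt /forallP H] i].
    split; first by have := H ord0; rewrite ffunE unlift_none.
    by apply/forallP => j; have := H (lift ord0 j); rewrite ffunE liftK.
  by rewrite ffunE; case: unliftP => [j|] _.
have Eprod g : (\prod_(i < k.+1) c g i = t * \prod_(i < k) g i)%N.
  rewrite big_ord_recl ffunE unlift_none; congr (_ * _)%N.
  by apply: eq_bigr => j _; rewrite ffunE liftK.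
transitivity (\sum_(g : {ffun 'I_k -> 'I_N.+1}) if prime t && [forall i, prime (g i)] then
   h (t * \prod_(i < k) g i)%N / (t * \prod_(i < k) g i)%N%:R else 0); last first.
  by apply: eq_bigr => g _; rewrite -/(c g) Eall Eprod.
case: (boolP (prime t)) => pt /=; last by rewrite big1.
rewrite IH mulr_sumr [LHS]big_mkcond; apply: eq_bigr => g _; case: ifP => // _.
by rewrite natrM invfM mulrCA.
Qed.

Lemma prime_tuple_sumE k s (x : R) :
  prime_tuple_sum k s x = tuple_lnX (Num.truncn x) k s x.
Proof.
rewrite /tuple_lnX tuple_sum_ffun /prime_tuple_sum [LHS]big_mkcondr; apply: eq_bigr => p _.
by case: ifP => _; rewrite ?mul0r.
Qed.
End Reindexing.

Theorem theorem1p1 (R : realType) (k s : nat) (hk : (0 < k)%N) (hs : (0 < s)%N) :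
  exists M : R, 0 < M /\
    \forall x \near (+oo : set_system R),
      `| prime_tuple_sum k s x
         - (\sum_(0 <= l < k)
              (-1) ^+ l * ((arr k l.+1)%:R / s%:R ^+ l.+1)
              * Pj (k - 1 - l) (log2 x) * ln x ^+ s
            + fmain k (2%:R : R) * ln (2%:R : R) ^+ (s - 1)) |
      <= M * (ln x ^+ (s - 1) * log2 x ^+ k).
Proof.
case: s hs => // s _; have -> : (s.+1 - 1 = s)%N by rewrite subn1.
have [C C0 HC] := @tuple_lnX_asymp R k k s (leqnSn k).
set c := fmain k 2%:R * _.
(* The number [c] does not depend on x, and for large x the error term is at least 1, so [c] is
   absorbed into M; the 1 keeps M positive. *)
exists (C + `|c| + 1); split; first by rewrite ltr_wpDl // addr_ge0.
near=> x.
(* This is the range of the estimates, reached as soon as x >= e^e. *)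
have v1 : 1 <= ln (ln x).
  have e0 := expR_gt0 (expR 1 : R).
  have xe : expR (expR 1) <= x by near: x; apply: nbhs_pinfty_ge; rewrite num_real.
  have ux : expR 1 <= ln x by rewrite -[leLHS]expRK ler_ln ?posrE //; lra.
  have e1 := expR_gt0 (1 : R).
  by rewrite -[leLHS]expRK ler_ln ?posrE //; lra.
have [u1 x2] := lnln_ge1 v1.
have h := HC (Num.truncn x) x v1 (leqnn _).
have E : main_term k k s.+1 x = \sum_(0 <= l < k) (-1) ^+ l * ((arr k l.+1)%:R / s.+1%:R ^+ l.+1)
              * Pj (k - 1 - l) (log2 x) * ln x ^+ s.+1.
  apply: eq_bigr => l _; rewrite Ppoly_Pj // -subnDA; exact: leq_subr.
rewrite prime_tuple_sumE -E /log2 opprD addrA.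
apply: le_trans (ler_normB _ _) _.
have p1 : 1 <= ln x ^+ s * ln (ln x) ^+ k.
  by rewrite mulr_ege1 // exprn_ege1 // ltW.
have : `|c| <= `|c| * (ln x ^+ s * ln (ln x) ^+ k) by rewrite ler_peMr.
rewrite mulrDl mulrDl; lra.
Unshelve. all: by end_near.
Qed.
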